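(* Let $L$ be a regular Lagrangian on $TQ$, $J$ a type $(1,1)$ tensor field on $Q$, and let $R$ be the type $(1,1)$ tensor field on $TQ$ defined by $i_{R(\xi)}\,d d_S L = i_\xi\, d d_{J^cS}L$ for all vector fields $\xi$ on $TQ$. Then $$N_R=0\iff N_J=0 .$$
   Context: $Q$ is a smooth $n$-dimensional manifold, $TQ$ has natural coordinates $(q^i,u^i)$. $L\in C^\infty(TQ)$ is regular: the Hessian $\partial^2L/\partial u^i\partial u^j$ is everywhere non-singular. $S=\frac{\partial}{\partial u^i}\otimes dq^i$ is the vertical endomorphism. A type $(1,1)$ tensor field $K$ acts on 1-forms by $(K\alpha)(\xi)=\alpha(K\xi)$, and $d_KL:=K(dL)=dL\circ K$. The 2-form $\omega_L=dd_SL$ is symplectic. The complete lift $J^c$ of $J$ to $TQ$ is the type $(1,1)$ tensor field with $J^c(X^c)=(JX)^c$, $J^c(X^V)=(JX)^V$ for vector fields $X$ on $Q$, where $X^c$, $X^V$ are the complete and vertical lifts of $X$ to $TQ$; $J^cS$ is the composition of endomorphisms. The Nijenhuis torsion of a type $(1,1)$ tensor field $K$ is $N_K(\xi,\eta)=[K\xi,K\eta]+K^2[\xi,\eta]-K([K\xi,\eta]+[\xi,K\eta])$. *)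

(* Defs.v *)
From HB Require Import structures.
From mathcomp Require Import all_boot all_order all_algebra.
From mathcomp Require Import all_classical all_reals all_analysis.

Set Implicit Arguments.
Unset Strict Implicit.
Unset Printing Implicit Defensive.

Import Order.TTheory GRing.Theory Num.Theory.
Import numFieldNormedType.Exports.

Local Open Scope classical_set_scope.
Local Open Scope ring_scope.

(** Smooth manifolds and tensor fields in MathComp-Analysis.

    A manifold is a set with a smooth atlas; its topology is the one induced by
    the charts.  A tensor field is given, classically, by its components in
    every chart of the atlas, subject to smoothness and to the tensorial
    transformation law.  Component functions are total on the manifold, but
    only their values on the domain of the chart are meaningful.
    A vector [v] is the row of its components v^a, a covector [c] the row of
    its components c_a, and a type (1,1) tensor [K] is the matrix with entry
    K^a_b in row [a], column [b]. *)

Section Smooth.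
Variables (R : realType) (n : nat).

(** On an open set [U] this is the usual class C^k. *)
Fixpoint Ck (k : nat) (U : set 'rV[R]_n) (f : 'rV[R]_n -> R) : Prop :=
  if k is k'.+1 then
    (forall x, U x -> differentiable f x) /\
    (forall a : 'I_n, Ck k' U (fun x => 'D_(delta_mx 0 a) f x))
  else forall x, U x -> {for x, continuous f}.

Definition smooth_on (U : set 'rV[R]_n) (f : 'rV[R]_n -> R) : Prop :=
  forall k, Ck k U f.

End Smooth.

(** The [dom i] and [coord i : dom i -> R^n] are the charts; the conditions
    making them a smooth atlas are collected in [smooth_manifold]. *)
Record atlas (R : realType) (n : nat) := Atlas {
  mpoint :> Type;
  chart : Type;
  dom : chart -> set mpoint;
  coord : chart -> mpoint -> 'rV[R]_n
}.

Section Manifold.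
Variables (R : realType) (n : nat) (M : atlas R n).
Implicit Types (i j : chart M) (x y : M) (f : M -> R).

(** [read i f] is f o (coord i)^-1 on the image of chart [i] (and unspecified
    elsewhere). *)
Definition read i f : 'rV[R]_n -> R := fun p =>
  get [set t : R | exists2 x, dom i x & coord i x = p /\ f x = t].

(** [pd i a f] is the partial derivative of [f] with respect to the [a]-th
    coordinate of chart [i]. *)
Definition pd i (a : 'I_n) f : M -> R := fun x =>
  'D_(delta_mx 0 a) (read i f) (coord i x).

(** The image under chart [i] of the part of [W] that it covers. *)
Definition chart_image i (W : set M) : set 'rV[R]_n :=
  coord i @` (dom i `&` W).

Definition mopen (W : set M) : Prop := forall i, open (chart_image i W).

Definition hausdorff_manifold : Prop := forall x y, x <> y ->
  exists A B : set M, [/\ mopen A, mopen B, A x, B y & A `&` B = set0].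

Definition second_countable_manifold : Prop :=
  exists2 B : nat -> set M, (forall k, mopen (B k)) &
    forall W x, mopen W -> W x -> exists2 k, B k x & B k `<=` W.

Record smooth_manifold : Prop := SmoothManifold {
  charts_cover : forall x, exists i, dom i x;
  coord_inj : forall i x y, dom i x -> dom i y ->
    coord i x = coord i y -> x = y;
  overlap_open : forall i j, open (chart_image i (dom j));
  transition_smooth : forall i j (a : 'I_n),
    smooth_on (chart_image i (dom j)) (read i (fun x => coord j x 0 a));
  manifold_hausdorff : hausdorff_manifold;
  manifold_second_countable : second_countable_manifold
}.

Definition smooth_in i f : Prop := smooth_on (chart_image i setT) (read i f).

Definition smooth_function f : Prop := forall i, smooth_in i f.

(** Entry (b, a) is the derivative of the b-th coordinate of chart [j] with
    respect to the a-th coordinate of chart [i]. *)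
Definition jac i j x : 'M[R]_n :=
  \matrix_(b, a) pd i a (fun y => coord j y 0 b) x.

(** Components, in every chart, of a vector field (or of a 1-form), of a type
    (1,1) tensor field, and of a 2-form. *)
Definition row_field := chart M -> M -> 'rV[R]_n.
Definition mx_field := chart M -> M -> 'M[R]_n.

Definition agree (xi eta : row_field) : Prop :=
  forall i x, dom i x -> xi i x = eta i x.

Definition is_vector_field (xi : row_field) : Prop :=
  (forall i a, smooth_in i (fun x => xi i x 0 a)) /\
  (forall i j x, dom i x -> dom j x -> xi j x = xi i x *m (jac i j x)^T).

Definition is_tensor11 (K : mx_field) : Prop :=
  (forall i a b, smooth_in i (fun x => K i x a b)) /\
  (forall i j x, dom i x -> dom j x -> K j x *m jac i j x = jac i j x *m K i x).

(** (K xi)^a = K^a_b xi^b *)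
Definition tapp (K : mx_field) (xi : row_field) : row_field :=
  fun i x => xi i x *m (K i x)^T.

Definition tcompose (K K' : mx_field) : mx_field := fun i x => K i x *m K' i x.

(** [xi, eta]^a = xi^b d_b eta^a - eta^b d_b xi^a *)
Definition bracket (xi eta : row_field) : row_field := fun i x =>
  \row_a \sum_b (xi i x 0 b * pd i b (fun y => eta i y 0 a) x
               - eta i x 0 b * pd i b (fun y => xi i y 0 a) x).

Definition nijenhuis (K : mx_field) (xi eta : row_field) : row_field :=
  bracket (tapp K xi) (tapp K eta) + tapp K (tapp K (bracket xi eta))
  - tapp K (bracket (tapp K xi) eta + bracket xi (tapp K eta)).

Definition nijenhuis_vanishes (K : mx_field) : Prop :=
  forall xi eta, is_vector_field xi -> is_vector_field eta ->
    agree (nijenhuis K xi eta) 0.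

Definition diff0 f : row_field := fun i x => \row_a pd i a f x.

(** (d alpha)_ab = d_a alpha_b - d_b alpha_a *)
Definition diff1 (alpha : row_field) : mx_field := fun i x =>
  \matrix_(a, b) (pd i a (fun y => alpha i y 0 b) x
                - pd i b (fun y => alpha i y 0 a) x).

(** d_K f = df o K, that is (d_K f)_b = (d_a f) K^a_b *)
Definition diffK (K : mx_field) f : row_field :=
  fun i x => diff0 f i x *m K i x.

(** (i_xi omega)_b = xi^a omega_ab *)
Definition interior_product (xi : row_field) (omega : mx_field) : row_field :=
  fun i x => xi i x *m omega i x.

(** A tangent vector assigns to each chart around its foot point a row of
    components, with the vector transformation law; the value 0 for the other
    charts only makes the representation unique. *)
Record tangent_vector := TangentVector {
  foot : M;
  tcomp : chart M -> 'rV[R]_n;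
  tcomp_transform : forall i j, dom i foot -> dom j foot ->
    tcomp j = tcomp i *m (jac i j foot)^T;
  tcomp_outside : forall i, ~ dom i foot -> tcomp i = 0
}.

(** The natural coordinates (q, u) on the tangent bundle: the first [n] are the
    q^a, the last [n] the u^a. *)
Definition tangent_bundle : atlas R (n + n) :=
  @Atlas R (n + n) tangent_vector (chart M)
    (fun i z => dom i (foot z))
    (fun i z => row_mx (coord i (foot z)) (tcomp z i)).

End Manifold.

Section TangentBundle.
Variables (R : realType) (n : nat) (Q : atlas R n).
Local Notation TQ := (tangent_bundle Q).

(** X^a d/du^a *)
Definition vertical_lift (X : row_field Q) : row_field TQ :=
  fun (i : chart Q) z => row_mx 0 (X i (foot z)).

(** X^a d/dq^a + u^b (dX^a/dq^b) d/du^a *)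
Definition complete_lift (X : row_field Q) : row_field TQ :=
  fun (i : chart Q) z =>
  row_mx (X i (foot z))
    (\row_a \sum_b tcomp z i 0 b * pd i b (fun y => X i y 0 a) (foot z)).

(** S = d/du^a (x) dq^a *)
Definition vertical_endomorphism : mx_field TQ :=
  fun _ _ => block_mx 0 0 1%:M 0.

Definition is_complete_lift (J : mx_field Q) (Jc : mx_field TQ) : Prop :=
  is_tensor11 Jc /\
  forall X, is_vector_field X ->
    agree (tapp Jc (complete_lift X)) (complete_lift (tapp J X)) /\
    agree (tapp Jc (vertical_lift X)) (vertical_lift (tapp J X)).

Definition hessian (L : TQ -> R) (i : chart Q) (z : TQ) : 'M[R]_n :=
  \matrix_(a, b) @pd _ _ TQ i (rshift n a) (@pd _ _ TQ i (rshift n b) L) z.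

Definition regular_lagrangian (L : TQ -> R) : Prop :=
  forall (i : chart Q) (z : TQ), dom i (foot z) -> hessian L i z \in unitmx.

End TangentBundle.

Arguments vertical_endomorphism {R n} Q.

(* Main.v *)
Require Import Defs.
From mathcomp Require Import all_boot all_order all_algebra.
From mathcomp Require Import all_classical all_reals all_analysis.
From mathcomp Require Import ring lra.
(* [dom] and [coord] have to mean the domain and the coordinates of a chart. *)
Import Defs.

(** Fix a chart of Q and the induced coordinates (q, u) of TQ, and write
    p_a = dL/du^a.  Then d_S L = p_a dq^a and, because J^c S sends d/dq^b to
    J^a_b d/du^a, also d_(J^c S) L = p_a J^a_b dq^b.  Put w0 = d d_S L and
    w1 = d d_(J^c S) L.  Vectors are rows, so a type (1,1) tensor K acts by
    right multiplication with its transpose; with A the transpose of T the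
    definition of T reads A w0 = w1.  The block of w0 that pairs the u-directions
    with the q-directions is the Hessian of L, so regularity makes w0 invertible.

    Comparing blocks in A w0 = w1 shows that A has the blocks J^T and 0 in its
    left half ([recursion_blocks]): T is projectable onto J.  The torsion of T
    therefore projects onto that of J ([torsion_at_base]), and N_T = 0 gives
    N_J = 0.

    For the converse put w2 = A w1.  Since w0 and w1 are closed, the torsion of T
    contracted with w0 is, up to sign, the exterior derivative of w2
    ([magri_morosi], whose pointwise content is [magri_algebra]).  On the other
    hand w2 is d(p_a (J^2)^a_b dq^b) plus the contraction of p with N_J
    ([recursion_square] and [defect_square]).  If N_J = 0 then w2 is exact, hence
    closed, and N_T = 0 because w0 is invertible.

    Both the vanishing of a torsion and the definition of T are statements about
    globally defined vector fields, whereas the argument is pointwise.  The bridge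
    is [vector_field_through]: on a Hausdorff manifold every tangent vector is a
    value of a global smooth vector field, obtained with a bump function whose
    compact support lies in one chart.  It is applied to Q and to TQ, which is why
    TQ is shown to be a Hausdorff manifold ([tangent_atlas],
    [tangent_hausdorff]); together with the tensoriality of the torsion
    ([nijenhuis_torsion_at]) it gives [nijenhuis_vanishesP].  That exact 2-forms
    are closed rests on the symmetry of second derivatives ([derive_swap]). *)

Set Implicit Arguments.
Unset Strict Implicit.
Unset Printing Implicit Defensive.

Import Order.TTheory GRing.Theory Num.Theory.
Import numFieldNormedType.Exports.

Local Open Scope classical_set_scope.
Local Open Scope ring_scope.

(** * Functions of class C^k on open sets of R^m *)

Section Calculus.
Variable R : realType.

(** The difference of the two functions vanishes near [p], so 0 is a
    differential of it there. *)
Lemma near_eq_differentiable (V W : normedModType R) (f g : V -> W) (p : V) :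
  (\forall q \near p, f q = g q) ->
  differentiable f p -> differentiable g p.
Proof.
move=> fg df; pose h : V -> W := g - f.
have gE : g = f + h by apply/funext => q; rewrite /h !fctE addrC subrK.
suff h1 : differentiable h p by rewrite gE; exact: differentiableD.
pose z : {linear V -> W} := \0.
have c0 : continuous z by move=> q; exact: cst_continuous.
have h0 : h \o shift p = cst (h p) + z +o_ (0 : V) id.
  apply/eqaddoP => e e0; near=> q => /=.
  rewrite !fctE /= /h !fctE.
  have -> : g p - f p = 0 by rewrite (nbhs_singleton fg) subrr.
  have -> : f (q + p) = g (q + p).
    near: q; move: fg; rewrite (near_shift 0) subr0.
    by [].
  by rewrite subrr !addr0 subr0 normr0 mulr_ge0// ltW.
have dh := diff_unique c0 h0.
by apply/diff_locallyP; rewrite dh.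
Unshelve. all: by end_near. Qed.

Lemma differentiable_row (V : normedModType R) m (tau : V -> 'rV[R]_m) (p : V) :
  (forall b, differentiable (fun q => tau q 0 b) p) -> differentiable tau p.
Proof.
move=> dtau.
have -> : tau = \sum_(b < m) (fun q => tau q 0 b *: (delta_mx 0 b : 'rV[R]_m)).
  by apply/funext => q; rewrite fct_sumE [LHS]row_sum_delta.
by apply: differentiable_sum => b; exact: differentiableZl.
Qed.

(** The chain rule in coordinates, for a map given by its components. *)
Lemma derive_comp (V : normedModType R) m (tau : V -> 'rV[R]_m)
    (f : 'rV[R]_m -> R) (p v : V) :
  (forall b, differentiable (fun q => tau q 0 b) p) ->
  differentiable f (tau p) ->
  'D_v (fun q => f (tau q)) p =
  \sum_b 'D_(delta_mx 0 b) f (tau p) * 'D_v (fun q => tau q 0 b) p.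
Proof.
move=> dtau df; have dt := differentiable_row dtau.
rewrite deriveE; last exact: (@differentiable_comp _ _ _ _ tau f).
rewrite (@diff_comp _ _ _ _ tau f)//= -(deriveE v dt).
rewrite derive_mx; last exact: diff_derivable.
rewrite [X in 'd f _ X]row_sum_delta linear_sum.
by apply: eq_bigr => b _; rewrite (deriveE _ df) linearZ mxE mulrC.
Qed.

Section OneSpace.
Variable m : nat.
Implicit Types (U V : set 'rV[R]_m) (f g : 'rV[R]_m -> R) (p v : 'rV[R]_m).

Lemma Ck_sub k U V f : V `<=` U -> Ck k U f -> Ck k V f.
Proof.
move=> VU; elim: k f => [|k IH] f /=; first by move=> fU x /VU /fU.
by move=> [df dkf]; split=> [x /VU /df//|a]; exact/IH/dkf.
Qed.

(** [Ck] constrains derivatives at the points of [U] only, so it can be checked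
    on pieces; the pieces need not be open. *)
Lemma Ck_local k U f :
  (forall p, U p -> exists2 V, V p & Ck k V f) -> Ck k U f.
Proof.
elim: k f => [|k IH] f UV /=; first by move=> p /UV[V Vp fV]; exact: fV.
split=> [p /UV[V Vp [dV _]]|a]; first exact: dV.
by apply: IH => p /UV[V Vp [_ dV]]; exists V => //; exact: dV.
Qed.

Lemma Ck_continuous k U f p : Ck k U f -> U p -> {for p, continuous f}.
Proof.
by case: k => [|k] fU Up; [exact: fU|exact/differentiable_continuous/(fU.1 p Up)].
Qed.

Lemma CkW k U f : Ck k.+1 U f -> Ck k U f.
Proof.
elim: k f => [|k IH] f; first by move=> fU x; exact: Ck_continuous fU.
by move=> [df dkf]; split=> // a; exact/IH/dkf.
Qed.

Lemma open_near_eq U f g p : open U -> (forall q, U q -> f q = g q) -> U p ->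
  \forall q \near p, f q = g q.
Proof. by move=> oU fg Up; near=> q; apply: fg; near: q; exact: open_nbhs_nbhs.
Unshelve. all: by end_near. Qed.

(** Openness matters: derivatives at a point of [U] see a neighbourhood of it. *)
Lemma Ck_eq k U f g : open U -> (forall p, U p -> f p = g p) ->
  Ck k U f -> Ck k U g.
Proof.
move=> oU; elim: k f g => [|k IH] f g fg /=.
  move=> fU p Up; have nfg := open_near_eq oU fg Up.
  rewrite /prop_for /continuous_at -(fg p Up).
  by apply: cvg_trans (fU p Up); apply: near_eq_cvg nfg.
move=> [df dkf]; split=> [p Up|a].
  by apply: near_eq_differentiable (df p Up); apply: open_near_eq fg Up.
by apply: IH (dkf a) => p Up; apply: near_eq_derive; apply: open_near_eq fg Up.
Qed.

Lemma Ck_cst k U (c : R) : open U -> Ck k U (fun=> c).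
Proof.
move=> oU; elim: k c => [|k IH] c /=; first by move=> p _; exact: cst_continuous.
split=> [p _|a]; first exact: differentiable_cst.
by apply: Ck_eq (IH 0) => // p _; rewrite derive_cst.
Qed.

Lemma Ck_add k U f g : open U -> Ck k U f -> Ck k U g ->
  Ck k U (fun p => f p + g p).
Proof.
move=> oU; elim: k f g => [|k IH] f g /=.
  by move=> fU gU p Up; apply: continuousD; [exact: fU|exact: gU].
move=> [df dkf] [dg dkg]; split=> [p Up|a].
  by apply: (@differentiableD _ _ _ f g); [exact: df|exact: dg].
apply: Ck_eq (IH _ _ (dkf a) (dkg a)) => // p Up.
by rewrite [RHS](@deriveD _ _ _ f g)//; apply: diff_derivable; [exact: df|exact: dg].
Qed.

Lemma Ck_mul k U f g : open U -> Ck k U f -> Ck k U g ->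
  Ck k U (fun p => f p * g p).
Proof.
move=> oU; elim: k f g => [|k IH] f g.
  by move=> fU gU p Up; apply: (@continuousM _ _ f g); [exact: fU|exact: gU].
move=> fU gU; have [df dkf] := fU; have [dg dkg] := gU; split=> [p Up|a].
  by apply: (@differentiableM _ _ f g); [exact: df|exact: dg].
apply: Ck_eq (Ck_add oU (IH _ _ (CkW fU) (dkg a)) (IH _ _ (CkW gU) (dkf a))) => //.
move=> p Up; rewrite [RHS](@deriveM _ _ f g)//; apply: diff_derivable;
  [exact: df|exact: dg].
Qed.

Lemma Ck_sum k U I (r : seq I) (F : I -> 'rV[R]_m -> R) : open U ->
  (forall i, Ck k U (F i)) -> Ck k U (fun p => \sum_(i <- r) F i p).
Proof.
move=> oU FU; elim: r => [|i r IH].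
  by apply: Ck_eq (Ck_cst k 0 oU) => // p _; rewrite big_nil.
by apply: Ck_eq (Ck_add oU (FU i) IH) => // p _; rewrite big_cons.
Qed.

Lemma derive_coord p v (b : 'I_m) : 'D_v (fun q : 'rV[R]_m => q 0 b) p = v 0 b.
Proof.
have := @derive_mx R 'rV[R]_m 1 m id p v (@derivable_id _ _ p v).
by rewrite derive_id => /matrixP/(_ 0 b); rewrite mxE.
Qed.

Lemma Ck_coord k U (b : 'I_m) : open U -> Ck k U (fun p => p 0 b).
Proof.
move=> oU; case: k => [|k] /=; first by move=> p _; exact: coord_continuous.
split=> [p _|a]; first exact: differentiable_coord.
by apply: Ck_eq (Ck_cst k ((delta_mx 0 a : 'rV[R]_m) 0 b) oU) => // p _;
  rewrite derive_coord.
Qed.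

End OneSpace.

Lemma smooth_diff m (U : set 'rV[R]_m) f p : smooth_on U f -> U p ->
  differentiable f p.
Proof. by move=> /(_ 1%N)[dU _]; exact: dU. Qed.

Lemma smooth_derive m (U : set 'rV[R]_m) f (a : 'I_m) : smooth_on U f ->
  smooth_on U ('D_(delta_mx 0 a) f).
Proof. by move=> fU k; have [_ dU] := fU k.+1; exact: dU. Qed.

(** By the chain rule the derivatives of the composite are sums of products of a
    derivative of [f] composed with [tau] and a derivative of [tau].  Induction on
    [k] applies to the first factors because [f] varies while [tau], smooth of
    every order, stays fixed. *)
Lemma Ck_comp m m' k (U : set 'rV[R]_m) (V : set 'rV[R]_m')
    (tau : 'rV[R]_m -> 'rV[R]_m') (f : 'rV[R]_m' -> R) :
  open U -> (forall p, U p -> V (tau p)) ->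
  (forall b, smooth_on U (fun p => tau p 0 b)) ->
  Ck k V f -> Ck k U (fun p => f (tau p)).
Proof.
move=> oU UV stau; elim: k f => [|k IH] f.
  move=> fV p Up; have ct : {for p, continuous tau}.
    apply/differentiable_continuous/differentiable_row => b.
    exact: smooth_diff (stau b) _.
  by apply: (@continuous_comp _ _ _ tau f) => //; exact/fV/UV.
move=> [df dkf]; split=> [p Up|a].
  apply: (@differentiable_comp _ _ _ _ tau f); last exact/df/UV.
  by apply: differentiable_row => b; have [+ _] := stau b 1%N; exact.
apply: (@Ck_eq _ _ _ (fun p => \sum_b 'D_(delta_mx 0 b) f (tau p) *
   'D_(delta_mx 0 a) (fun q => tau q 0 b) p)) => // [p Up|].
  rewrite -derive_comp// => [b|]; last exact/df/UV.
  exact: smooth_diff (stau b) _.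
apply: Ck_sum => // b; apply: Ck_mul => //; first exact: IH (dkf b).
exact: smooth_derive (stau b) k.
Qed.

End Calculus.

(** * Symmetry of second derivatives *)

Section Schwarz.
Variables (R : realType) (m : nat).
Implicit Types (U : set 'rV[R]_m) (f : 'rV[R]_m -> R) (p q v w : 'rV[R]_m).

Lemma is_derive_line f q v (s : R) : differentiable f (q + s *: v) ->
  is_derive s 1 (fun t : R => f (q + t *: v)) ('D_v f (q + s *: v)).
Proof.
move=> df.
have dZ : differentiable (fun t : R => t *: v) s by exact: ex_diff.
have dl1 : differentiable (fun t : R => q + t *: v) s.
  exact: (@differentiableD _ _ _ (cst q) (fun t : R => t *: v)).
have dl : 'd (fun t : R => q + t *: v) s 1 = v.
  rewrite -(deriveE _ dl1) (@deriveD _ _ _ (cst q) (fun t : R => t *: v)) //.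
    by rewrite derive_cst add0r (deriveE _ dZ) diff_val scale1r.
  exact: diff_derivable.
have dfl : differentiable (fun t : R => f (q + t *: v)) s.
  exact: (@differentiable_comp _ _ _ _ (fun t : R => q + t *: v) f).
apply: DeriveDef; first exact: diff_derivable.
rewrite (deriveE _ dfl) (deriveE _ df).
by rewrite (@diff_comp _ _ _ _ (fun t : R => q + t *: v) f)//= dl.
Qed.

Lemma MVT_line (g dg : R -> R) (h : R) : 0 < h ->
  (forall s, 0 <= s <= h -> is_derive s 1 g (dg s)) ->
  exists2 s, 0 < s < h & g h - g 0 = h * dg s.
Proof.
move=> h0 dgs; have [|//|s] := MVT h0 _ _ (f := g) (df := dg).
- by move=> s; rewrite in_itv /= => /andP[/ltW s0 /ltW sh]; apply: dgs; rewrite s0.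
- apply: derivable_within_continuous => s; rewrite in_itv /= => /dgs.
  by case.
by rewrite in_itv /= subr0 => sh ->; exists s => //; rewrite mulrC.
Qed.

(** The mixed second difference of [f] over the parallelogram on [h v] and [h w]:
    the mean value theorem is applied first to the increment of [f] along [h w],
    as a function of the position along [v], then to ['D_v f] along [w]. *)
Lemma second_difference U f p v w (h : R) : 0 < h ->
  (forall s t : R, 0 <= s <= h -> 0 <= t <= h -> U (p + s *: v + t *: w)) ->
  (forall q, U q -> differentiable f q) ->
  (forall q, U q -> differentiable ('D_v f) q) ->
  exists s t : R, [/\ 0 < s < h, 0 < t < h &
    f (p + h *: v + h *: w) - f (p + h *: v) - f (p + h *: w) + f p =
    h * (h * 'D_w ('D_v f) (p + s *: v + t *: w))].
Proof.
move=> h0 inU df ddf.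
have hh : 0 <= h <= h by rewrite lexx ltW.
have oh : 0 <= (0 : R) <= h by apply/andP; split => //; exact: ltW.
pose g s := f (p + h *: w + s *: v) - f (p + s *: v).
pose dg s := 'D_v f (p + h *: w + s *: v) - 'D_v f (p + s *: v).
have [s sh|s sh gs] := MVT_line (g := g) (dg := dg) h0.
  apply: is_deriveB; apply: is_derive_line; apply: df.
    by rewrite addrAC; exact: inU.
  by have := inU s 0 sh oh; rewrite scale0r addr0.
have [/ltW s0 /ltW s1] := andP sh.
have [t th|t th gt] := MVT_line (g := fun t => 'D_v f (p + s *: v + t *: w))
  (dg := fun t => 'D_w ('D_v f) (p + s *: v + t *: w)) h0.
  by apply: is_derive_line; apply: ddf; apply: inU => //; rewrite s0.
exists s, t; split => //; rewrite -gt.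
rewrite -[in 'D_v f (p + s *: v + 0 *: w)]addrA scale0r addr0.
move: gs; rewrite /dg /g scale0r !addr0 (addrAC p (h *: w)).
rewrite (addrAC p (h *: w) (s *: v)) => <-; ring.
Qed.

(** The second difference is symmetric in the two directions, so
    [second_difference] evaluates both mixed derivatives at points that tend to
    [p], where they agree; continuity transports the equality to [p]. *)
Lemma derive_swap U f p (a b : 'I_m) : open U -> smooth_on U f -> U p ->
  'D_(delta_mx 0 a) ('D_(delta_mx 0 b) f) p =
  'D_(delta_mx 0 b) ('D_(delta_mx 0 a) f) p.
Proof.
move=> oU fU Up; set v := delta_mx 0 a; set w := delta_mx 0 b.
set A := LHS; set B := RHS; apply/eqP; rewrite -subr_eq0 -normr_le0.
apply/ler_addgt0Pr => e e0; rewrite add0r.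
have dvw : forall c d : 'I_m,
    {for p, continuous ('D_(delta_mx 0 c) ('D_(delta_mx 0 d) f))}.
  move=> c d; apply/differentiable_continuous/smooth_diff/Up.
  exact/smooth_derive/smooth_derive.
have e20 : 0 < e / 2 by rewrite divr_gt0.
have : \forall q \near p, [/\ U q, `|A - 'D_v ('D_w f) q| < e / 2
     & `|B - 'D_w ('D_v f) q| < e / 2].
  have nU : nbhs p U by apply: open_nbhs_nbhs; split.
  have nF : Filter (nbhs p) := nbhs_filter p.
  have nA := (cvgrPdist_lt _ _).1 (dvw a b) _ e20.
  have nB := (cvgrPdist_lt _ _).1 (dvw b a) _ e20.
  have nAB := @filterI _ _ nF _ _ nU (@filterI _ _ nF _ _ (nA nF) (nB nF)).
  apply: (@filterS _ _ nF _ _ _ nAB) => q [Uq [Aq Bq]].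
  exact (And3 Uq Aq Bq).
move=> /nbhs_ballP[d /= d0 pd].
(* [h] is so small that the whole parallelogram lies in the ball. *)
pose M := `|v| + `|w| + 1.
have M0 : 0 < M by rewrite ltr_wpDl// addr_ge0.
pose h := d / (M * 2).
have h0 : 0 < h by rewrite divr_gt0// mulr_gt0.
have near_p (s t : R) : 0 <= s <= h -> 0 <= t <= h ->
    ball p d (p + s *: v + t *: w).
  move=> /andP[s0 sh] /andP[t0 th]; rewrite -ball_normE /ball_ /=.
  rewrite -addrA opprD addrA subrr add0r normrN.
  apply: le_lt_trans (ler_normD _ _) _; rewrite !normrZ !ger0_norm//.
  apply: (@le_lt_trans _ _ (h * `|v| + h * `|w|)).
    by rewrite lerD// ler_wpM2r.
  rewrite -mulrDr; apply: (@lt_trans _ _ (h * M)).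
    by rewrite ltr_pM2l// ltrDl.
  rewrite /h invfM mulrA -mulrA (mulrC _ M) mulrA -(mulrA d) mulVf ?gt_eqF//.
  by rewrite mulr1 ltr_pdivrMr// ltr_pMr// ltr1n.
have [s1 [t1 [s1h t1h E1]]] := @second_difference U f p v w h h0
  (fun s t sh th => let: And3 u _ _ := pd _ (near_p s t sh th) in u)
  (fun q => smooth_diff fU) (fun q => smooth_diff (smooth_derive a fU)).
have near_p' (s t : R) : 0 <= s <= h -> 0 <= t <= h ->
    ball p d (p + s *: w + t *: v).
  by move=> sh th; rewrite addrAC; exact: near_p.
have [s2 [t2 [s2h t2h E2]]] := @second_difference U f p w v h h0
  (fun s t sh th => let: And3 u _ _ := pd _ (near_p' s t sh th) in u)
  (fun q => smooth_diff fU) (fun q => smooth_diff (smooth_derive b fU)).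
have weak (s : R) : 0 < s < h -> 0 <= s <= h.
  by move=> /andP[/ltW -> /ltW ->].
have [_ _ B1] := pd _ (near_p _ _ (weak _ s1h) (weak _ t1h)).
have [_ A2 _] := pd _ (near_p' _ _ (weak _ s2h) (weak _ t2h)).
have E : 'D_w ('D_v f) (p + s1 *: v + t1 *: w) =
         'D_v ('D_w f) (p + s2 *: w + t2 *: v).
  apply: (mulfI (lt0r_neq0 h0)); apply: (mulfI (lt0r_neq0 h0)).
  refine (etrans (esym E1) (etrans _ E2)).
  by rewrite (addrAC p (h *: w)) (addrAC (f _)).
rewrite E in B1; rewrite [e]splitr.
have -> : A - B = (A - 'D_v ('D_w f) (p + s2 *: w + t2 *: v)) -
                  (B - 'D_v ('D_w f) (p + s2 *: w + t2 *: v)) by ring.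
apply: le_trans (ler_normB _ _) _.
exact (lerD (ltW A2) (ltW B1)).
Qed.

End Schwarz.

(** * A smooth function supported in a ball *)

Section Bump.
Variable R : realType.

(** x^(-k) exp(-1/x) continued by 0.  The family is closed under
    differentiation up to linear combinations, which replaces a discussion of the
    higher derivatives of exp(-1/x). *)
Definition flat (k : nat) (x : R) : R :=
  if 0 < x then x^-1 ^+ k * expR (- x^-1) else 0.

Lemma flat_ge0 k x : 0 <= flat k x.
Proof.
rewrite /flat; case: ifP => // x0.
by rewrite mulr_ge0 ?expR_ge0// exprn_ge0// invr_ge0 ltW.
Qed.

(** Comparison of exp y with (y/N)^N for y = 1/x and N = k+1: it makes every
    [flat k] differentiable at 0, since [flat k x / x = flat k.+1 x]. *)
Lemma flat_le k x : flat k x <= k.+1%:R ^+ k.+1 * `|x|.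
Proof.
rewrite /flat; case: ifP => x0; last by rewrite mulr_ge0// exprn_ge0.
rewrite gtr0_norm// expRN.
have y0 : 0 < x^-1 by rewrite invr_gt0.
have N0 : 0 < k.+1%:R :> R by rewrite ltr0n.
have : (x^-1 / k.+1%:R) ^+ k.+1 <= expR x^-1.
  have -> : expR x^-1 = expR (x^-1 / k.+1%:R) ^+ k.+1.
    by rewrite -expRM_natr divfK// gt_eqF.
  rewrite lerXn2r ?nnegrE ?expR_ge0//; first by rewrite divr_ge0// ltW.
  by apply: le_trans (expR_ge1Dx _); rewrite lerDr.
rewrite expr_div_n ler_pdivrMr ?exprn_gt0// exprS => le1.
have -> : x^-1 ^+ k = x * (x^-1 * x^-1 ^+ k).
  by rewrite mulrA divff ?mul1r// gt_eqF.
rewrite -mulrA (mulrC _ x) ler_wpM2l ?(ltW x0)//.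
by rewrite ler_pdivrMr ?expR_gt0// [leRHS]mulrC.
Qed.

Lemma flatS k x : flat k x = x * flat k.+1 x.
Proof.
rewrite /flat; case: ifP => x0; last by rewrite mulr0.
by rewrite exprS !mulrA divff ?mul1r// gt_eqF.
Qed.

Lemma is_derive_flat k (x : R) :
  is_derive x 1 (flat k) (flat k.+2 x - k%:R * flat k.+1 x).
Proof.
case: (ltgtP x 0) => x0.
- have -> : flat k.+2 x - k%:R * flat k.+1 x = 0.
    by rewrite /flat ltNge (ltW x0) /= mulr0 subr0.
  apply: (@near_eq_is_derive _ _ _ (cst 0)).
  by near=> y; rewrite /flat ltNge ltW//; near: y; exact: lt_nbhsl.
- have xn0 := lt0r_neq0 x0.
  apply: (@near_eq_is_derive _ _ _ ((fun y => y^-1) ^+ k * (expR \o (fun y => - y^-1)))).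
    near=> y; rewrite /flat ifT; first by rewrite !fctE.
    by near: y; exact: lt_nbhsr.
  have dV : is_derive x 1 (fun y : R => y^-1) (- x ^- 2).
    apply: is_derive_eq; first exact: (is_deriveV (f := id)).
    by rewrite scaler1.
  have dE : is_derive x 1 (expR \o (fun y : R => - y^-1)) (x ^- 2 * expR (- x^-1)).
    have dN : is_derive x 1 (fun y : R => - y^-1) (x ^- 2).
      by rewrite -[x ^- 2]opprK; exact: is_deriveN.
    have := @is_derive1_comp R expR (fun y : R => - y^-1) x _ _
      (is_derive_expR _) dN.
    by rewrite mulrC.
  have := @is_deriveM R R _ _ x 1 _ _ (is_deriveX k dV) dE.
  congr (is_derive x 1 _ _).
  rewrite /flat x0 !fctE /GRing.scale /=.
  case: k {dE dV} => [|k]; first by rewrite /= !mul0r expr0; field.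
  by rewrite /= !exprS expr0; field.
- subst x; have f0 j : flat j 0 = 0 by rewrite /flat ltxx.
  rewrite !f0 mulr0 subr0.
  have lim0 : h^-1 *: (flat k (h *: 1 + 0) - flat k 0) @[h --> 0^'] --> (0 : R).
    apply/cvgrPdist_le => e e0; near=> h.
    have hn0 : h != 0 by near: h; exact: nbhs_dnbhs_neq.
    rewrite f0 addr0 subr0 sub0r normrN [h%:A]mulr1 flatS /GRing.scale /= mulKf//.
    rewrite ger0_norm ?flat_ge0//; apply: (le_trans (flat_le _ _)).
    rewrite mulrC -ler_pdivlMr ?exprn_gt0//.
    by near: h; apply: dnbhs0_le; rewrite divr_gt0// exprn_gt0.
  by apply: DeriveDef; [apply/cvg_ex; exists 0|exact: cvg_lim].
Unshelve. all: by end_near. Qed.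

Lemma derive_comp_real (V : normedModType R) (s : V -> R) (g : R -> R) (p v : V) :
  differentiable s p -> differentiable g (s p) ->
  'D_v (fun q => g (s q)) p = 'D_1 g (s p) * 'D_v s p.
Proof.
move=> ds dg; rewrite (deriveE _ ds) (deriveE _ dg).
rewrite deriveE; last exact: (@differentiable_comp _ _ _ _ s g).
rewrite (@diff_comp _ _ _ _ s g)//= -[X in 'd g _ X]mulr1 linearZ.
exact: mulrC.
Qed.

(** Induction on the order, for all [j] at once: the derivative of [flat j]
    involves [flat j.+1] and [flat j.+2]. *)
Lemma smooth_flat m (U : set 'rV[R]_m) (s : 'rV[R]_m -> R) j :
  open U -> smooth_on U s -> smooth_on U (fun p => flat j (s p)).
Proof.
move=> oU sU k; have df i y : differentiable (flat i) y.
  by apply/derivable1_diffP; have [] := is_derive_flat i y.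
elim: k j => [|k IH] j.
  move=> p Up; apply: (@continuous_comp _ _ _ s (flat j)).
    exact/differentiable_continuous/smooth_diff/Up.
  exact/differentiable_continuous.
split=> [p Up|a].
  by apply: (@differentiable_comp _ _ _ _ s (flat j)) => //; exact: smooth_diff sU Up.
apply: (@Ck_eq _ _ _ _ (fun p => (flat j.+2 (s p) + (- j%:R) * flat j.+1 (s p))
   * 'D_(delta_mx 0 a) s p)) => //.
  move=> p Up; rewrite derive_comp_real//; last exact: smooth_diff sU Up.
  by have [_ ->] := is_derive_flat j (s p); rewrite mulNr.
apply: Ck_mul => //; last exact: smooth_derive.
by apply: Ck_add => //; apply: Ck_mul => //; exact: Ck_cst.
Qed.

(** exp(-1/(r^2 - |p - c|^2)) for the Euclidean distance, inside the ball of
    radius [r] around [c], and 0 outside. *)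
Definition radial_bump m (c : 'rV[R]_m) (r : R) (p : 'rV[R]_m) : R :=
  flat 0 (r ^+ 2 + (-1) * \sum_a (p 0 a - c 0 a) * (p 0 a - c 0 a)).

Lemma smooth_bump m (c : 'rV[R]_m) r : smooth_on setT (radial_bump c r).
Proof.
apply: smooth_flat; first exact: openT.
move=> k; have oT := @openT 'rV[R]_m.
apply: Ck_add => //; first exact: Ck_cst.
apply: Ck_mul => //; first exact: Ck_cst.
apply: Ck_sum => // a.
by apply: Ck_mul => //; apply: Ck_add => //; [exact: Ck_coord|exact: Ck_cst|
  exact: Ck_coord|exact: Ck_cst].
Qed.

Lemma bump_center m (c : 'rV[R]_m) r : 0 < r -> radial_bump c r c != 0.
Proof.
move=> r0; rewrite /radial_bump big1 => [|a _]; last by rewrite subrr mulr0.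
by rewrite mulr0 addr0 /flat exprn_gt0// mul1r gt_eqF// expR_gt0.
Qed.

(** The norm of 'rV is the maximum norm: outside its closed ball some single
    coordinate already makes the Euclidean distance exceed [r]. *)
Lemma bump_outside m (c : 'rV[R]_m) r p : 0 < r ->
  ~ `|p - c| <= r -> radial_bump c r p = 0.
Proof.
move=> r0 pr; have [a ar] : exists a, r < `|p 0 a - c 0 a|.
  apply: contrapT => nex; apply: pr.
  rewrite /Num.Def.normr/= mx_normrE; apply: bigmax_le; first exact: ltW.
  move=> [i a] _ /=; rewrite (ord1 i) !mxE leNgt; apply/negP => lt.
  by apply: nex; exists a.
rewrite /radial_bump /flat ifF//; apply/negbTE; rewrite -leNgt mulN1r subr_le0.
rewrite (bigD1 a)//= -expr2; apply: (@le_trans _ _ ((p 0 a - c 0 a) ^+ 2)).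
  by rewrite -[leRHS]real_normK ?num_real// lerXn2r ?nnegrE// ltW.
by rewrite lerDl sumr_ge0// => b _; rewrite -expr2 sqr_ge0.
Qed.

End Bump.

(** * Calculus in charts *)

(** The part of [smooth_manifold] that local computations use.  It is isolated
    because topological facts about TQ, such as being Hausdorff, are derived from
    the smoothness of its transition maps. *)
Record smooth_atlas (R : realType) (n : nat) (M : atlas R n) : Prop := {
  sa_inj : forall (i : chart M) x y, dom i x -> dom i y ->
    coord i x = coord i y -> x = y;
  sa_open : forall i j : chart M, open (chart_image i (dom j));
  sa_smooth : forall (i j : chart M) (a : 'I_n),
    smooth_on (chart_image i (dom j)) (read i (fun x => coord j x 0 a))
}.

Lemma read_coord (R : realType) (n : nat) (M : atlas R n) (i : chart M)
    (f : M -> R) (x : M) : dom i x ->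
  (forall y, dom i y -> coord i y = coord i x -> y = x) ->
  read i f (coord i x) = f x.
Proof.
move=> ix inj; rewrite /read; set A := [set t | _].
have : A (get A) by apply: (@getPex _ A); exists (f x), x.
by case=> y iy [/(inj _ iy) -> <-].
Qed.

Section Charts.
Variables (R : realType) (n : nat) (M : atlas R n).
Hypothesis HM : smooth_atlas M.
Implicit Types (i j k : chart M) (x y : M) (f g : M -> R) (W : set M).

Lemma readE i f x : dom i x -> read i f (coord i x) = f x.
Proof. by move=> ix; apply: read_coord => // y iy; exact: (sa_inj HM). Qed.

Lemma chart_image_sub i W W' : W `<=` W' -> chart_image i W `<=` chart_image i W'.
Proof. by move=> WW' _ [x [ix /WW' Wx] <-]; exists x. Qed.

Lemma mopen_dom i : mopen (dom i).
Proof. by move=> j; exact: sa_open. Qed.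
Arguments mopen_dom : clear implicits.

Lemma mopenT : mopen [set: M].
Proof.
move=> i; rewrite (_ : chart_image i setT = chart_image i (dom i)).
  exact: mopen_dom.
by apply/seteqP; split=> _ [x [ix _] <-]; exists x.
Qed.

Lemma mopenI W W' : mopen W -> mopen W' -> mopen (W `&` W').
Proof.
move=> oW oW' i; rewrite (_ : chart_image i _ = chart_image i W `&` chart_image i W').
  exact: openI.
apply/seteqP; split=> [_ [x [ix [Wx W'x]] <-]|p]; first by split; exists x.
move=> [[x [ix Wx] <-] [y [iy Wy] /(sa_inj HM iy ix) yx]]; subst y.
by exists x.
Qed.

Lemma mopen_nbhs W i x : mopen W -> dom i x -> W x ->
  nbhs (coord i x) (chart_image i W).
Proof. by move=> oW ix Wx; apply: open_nbhs_nbhs; split; [|exists x]. Qed.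

Definition transition i j (p : 'rV[R]_n) : 'rV[R]_n :=
  \row_b read i (fun x => coord j x 0 b) p.

Lemma transitionE i j x : dom i x -> transition i j (coord i x) = coord j x.
Proof. by move=> ix; apply/rowP => b; rewrite mxE readE. Qed.

Lemma smooth_transition i j b :
  smooth_on (chart_image i (dom j)) (fun p => transition i j p 0 b).
Proof.
rewrite (_ : (fun p => _) = read i (fun x => coord j x 0 b)); first exact: sa_smooth.
by apply/funext => p; rewrite mxE.
Qed.
Arguments smooth_transition : clear implicits.

(** Chart coordinates are continuous for the manifold topology: seen in another
    chart they are a transition map. *)
Lemma mopen_preimage i (O : set 'rV[R]_n) : open O ->
  mopen [set x | dom i x /\ O (coord i x)].
Proof.
move=> oO j; rewrite openE => _ [x [jx [ix Ox]] <-].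
have ct : {for coord j x, continuous (transition j i)}.
  apply/differentiable_continuous/differentiable_row => b.
  by apply: smooth_diff (smooth_transition j i b) _; exists x.
have nO : nbhs (coord j x) (transition j i @^-1` O).
  by apply: ct; rewrite transitionE//; exact: open_nbhs_nbhs.
apply: filterS (filterI (mopen_nbhs (mopen_dom i) jx ix) nO).
move=> _ [[y [jy iy] <-]] /=; rewrite transitionE// => Oy.
by exists y.
Qed.

(** Smoothness of [f], seen in chart [i], on the part of [W] that the chart
    covers; for [W = setT] this is [smooth_in]. *)
Definition smooth_within i W f := smooth_on (chart_image i W) (read i f).

Lemma smooth_within_sub i W W' f : W `<=` W' -> smooth_within i W' f ->
  smooth_within i W f.
Proof. by move=> WW' fW k; exact: Ck_sub (chart_image_sub WW') (fW k). Qed.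

Lemma smooth_within_eq i W f g : mopen W ->
  (forall x, dom i x -> W x -> f x = g x) ->
  smooth_within i W f -> smooth_within i W g.
Proof.
move=> oW fg fW k; apply: Ck_eq (fW k) => // _ [x [ix Wx] <-].
by rewrite !readE// fg.
Qed.

Lemma smooth_within_cst i W c : mopen W -> smooth_within i W (fun=> c).
Proof.
move=> oW k; apply: (Ck_eq _ _ (Ck_cst k c (oW i))) => // _ [x [ix Wx] <-].
by rewrite readE.
Qed.

Lemma smooth_within_add i W f g : mopen W -> smooth_within i W f ->
  smooth_within i W g -> smooth_within i W (fun x => f x + g x).
Proof.
move=> oW fW gW k; apply: (Ck_eq _ _ (Ck_add (oW i) (fW k) (gW k))) => //.
by move=> _ [x [ix Wx] <-]; rewrite !readE.
Qed.

Lemma smooth_within_mul i W f g : mopen W -> smooth_within i W f ->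
  smooth_within i W g -> smooth_within i W (fun x => f x * g x).
Proof.
move=> oW fW gW k; apply: (Ck_eq _ _ (Ck_mul (oW i) (fW k) (gW k))) => //.
by move=> _ [x [ix Wx] <-]; rewrite !readE.
Qed.

Lemma smooth_within_sum i W I (r : seq I) (F : I -> M -> R) : mopen W ->
  (forall c, smooth_within i W (F c)) ->
  smooth_within i W (fun x => \sum_(c <- r) F c x).
Proof.
move=> oW FW; elim: r => [|c r IH].
  apply: smooth_within_eq (smooth_within_cst i 0 oW) => // x _ _.
  by rewrite big_nil.
apply: smooth_within_eq (smooth_within_add oW (FW c) IH) => // x _ _.
by rewrite big_cons.
Qed.

Lemma smooth_within_pd i W f a : mopen W -> smooth_within i W f ->
  smooth_within i W (pd i a f).
Proof.
move=> oW fW k; apply: (Ck_eq _ _ (smooth_derive a fW k)) => //.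
by move=> _ [x [ix Wx] <-]; rewrite readE.
Qed.

Lemma smooth_within_coord i j b : smooth_within i (dom j) (fun x => coord j x 0 b).
Proof. exact: sa_smooth. Qed.
Arguments smooth_within_coord : clear implicits.

Lemma smooth_within_change i j W f : mopen W -> W `<=` dom j ->
  smooth_within j W f -> smooth_within i W f.
Proof.
move=> oW Wj fW k.
apply: (@Ck_eq _ _ _ _ (fun p => read j f (transition i j p))) => //.
  by move=> _ [x [ix Wx] <-]; rewrite transitionE// !readE//; exact: Wj.
apply: Ck_comp (fW k) => // [_ [x [ix Wx] <-]|b l].
  by rewrite transitionE//; exists x; split => //; exact: Wj.
exact: Ck_sub (chart_image_sub Wj) (smooth_transition i j b l).
Qed.

Lemma pd_eq i W f g a x : mopen W -> (forall y, dom i y -> W y -> f y = g y) ->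
  dom i x -> W x -> pd i a f x = pd i a g x.
Proof.
move=> oW fg ix Wx; apply: near_eq_derive.
apply: filterS (mopen_nbhs oW ix Wx) => _ [y [iy Wy] <-].
by rewrite !readE// fg.
Qed.

Lemma read_diff i W f x : mopen W -> smooth_within i W f -> dom i x -> W x ->
  differentiable (read i f) (coord i x).
Proof. by move=> oW fW ix Wx; apply: smooth_diff fW _; exists x. Qed.

Lemma pd_cst i c a x : dom i x -> pd i a (fun=> c) x = 0.
Proof.
move=> ix; rewrite /pd -[RHS](@derive_cst _ _ _ c (coord i x) (delta_mx 0 a)).
apply: near_eq_derive; apply: filterS (mopen_nbhs mopenT ix I) => _ [y [iy _] <-].
by rewrite readE.
Qed.

Lemma pd_add i W f g a x : mopen W -> smooth_within i W f ->
  smooth_within i W g -> dom i x -> W x ->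
  pd i a (fun y => f y + g y) x = pd i a f x + pd i a g x.
Proof.
move=> oW fW gW ix Wx; rewrite /pd -deriveD;
  [|exact/diff_derivable/(read_diff oW fW)|exact/diff_derivable/(read_diff oW gW)].
apply: near_eq_derive; apply: filterS (mopen_nbhs oW ix Wx) => _ [y [iy _] <-].
by rewrite !fctE !readE.
Qed.

Lemma pd_mul i W f g a x : mopen W -> smooth_within i W f ->
  smooth_within i W g -> dom i x -> W x ->
  pd i a (fun y => f y * g y) x = pd i a f x * g x + f x * pd i a g x.
Proof.
move=> oW fW gW ix Wx.
transitivity ('D_(delta_mx 0 a) (read i f * read i g) (coord i x)).
  apply: near_eq_derive; apply: filterS (mopen_nbhs oW ix Wx) => _ [y [iy _] <-].
  by rewrite !fctE !readE.
rewrite deriveM;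
  [|exact/diff_derivable/(read_diff oW fW)|exact/diff_derivable/(read_diff oW gW)].
by rewrite !(readE _ ix) [LHS]addrC [X in X + _]mulrC.
Qed.

Lemma pd_sum i W I (r : seq I) (F : I -> M -> R) a x : mopen W ->
  (forall c, smooth_within i W (F c)) -> dom i x -> W x ->
  pd i a (fun y => \sum_(c <- r) F c y) x = \sum_(c <- r) pd i a (F c) x.
Proof.
move=> oW FW ix Wx; elim: r => [|c r IH].
  rewrite big_nil -[RHS](@pd_cst i 0 a x)//.
  by apply: (pd_eq _ oW) => // y _ _; rewrite big_nil.
rewrite big_cons -IH -(pd_add _ oW)//; last exact: smooth_within_sum.
by apply: (pd_eq _ oW) => // y _ _; rewrite big_cons.
Qed.

Lemma pd_swap i W f a b x : mopen W -> smooth_within i W f -> dom i x -> W x ->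
  pd i a (pd i b f) x = pd i b (pd i a f) x.
Proof.
move=> oW fW ix Wx.
have E c d : pd i c (pd i d f) x =
    'D_(delta_mx 0 c) ('D_(delta_mx 0 d) (read i f)) (coord i x).
  apply: near_eq_derive; apply: filterS (mopen_nbhs oW ix Wx) => _ [y [iy _] <-].
  by rewrite readE.
rewrite !E; apply: derive_swap (oW i) fW _.
by exists x.
Qed.

(** The chain rule for a change of chart. *)
Lemma pd_change i j W f a x : mopen W -> smooth_within j W f ->
  dom i x -> dom j x -> W x ->
  pd i a f x = \sum_b pd j b f x * jac i j x b a.
Proof.
move=> oW fW ix jx Wx.
have dt b : differentiable (fun p => transition i j p 0 b) (coord i x).
  by apply: smooth_diff (smooth_transition i j b) _; exists x.
transitivity ('D_(delta_mx 0 a) (fun p => read j f (transition i j p)) (coord i x)).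
  apply: near_eq_derive.
  apply: filterS (mopen_nbhs (mopenI oW (mopen_dom j)) ix (conj Wx jx)).
  by move=> _ [y [iy [Wy jy]] <-]; rewrite transitionE// !readE.
rewrite derive_comp// transitionE//; last exact: read_diff oW fW jx Wx.
have tE b : read i (fun y => coord j y 0 b) = fun p => transition i j p 0 b.
  by apply/funext => p; rewrite mxE.
by apply: eq_bigr => b _; rewrite mxE /pd tE.
Qed.

Lemma jac_comp i j k x : dom i x -> dom j x -> dom k x ->
  jac j k x *m jac i j x = jac i k x.
Proof.
move=> ix jx kx; apply/matrixP => b a; rewrite !mxE.
rewrite (pd_change _ (mopen_dom k) (smooth_within_coord j k b) ix jx kx).
by apply: eq_bigr => c _; rewrite mxE.
Qed.

Lemma jac_id i x : dom i x -> jac i i x = 1%:M.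
Proof.
move=> ix; apply/matrixP => b a; rewrite !mxE.
transitivity ('D_(delta_mx 0 a) (fun p : 'rV[R]_n => p 0 b) (coord i x)).
  apply: near_eq_derive; apply: filterS (mopen_nbhs mopenT ix I) => _ [y [iy _] <-].
  by rewrite readE.
by rewrite derive_coord mxE eqxx.
Qed.

Lemma smooth_within_jac i j k b a :
  smooth_within k (dom i `&` dom j) (fun x => jac i j x b a).
Proof.
have oij := mopenI (mopen_dom i) (mopen_dom j).
apply: (@smooth_within_change k i _ _ oij (fun y ij => proj1 ij)).
apply: (@smooth_within_eq _ _ (pd i a (fun y => coord j y 0 b))) => //.
  by move=> x _ _; rewrite mxE.
apply: smooth_within_pd => //.
exact: smooth_within_sub (fun y ij => proj2 ij) (smooth_within_coord i j b).
Qed.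
Arguments smooth_within_jac : clear implicits.

End Charts.

Arguments mopen_dom {R n M} HM i.
Arguments smooth_transition {R n M} HM i j b.
Arguments smooth_within_coord {R n M} HM i j b.
Arguments smooth_within_jac {R n M} HM i j k b a.

(** * Vector fields with a prescribed value *)

Section VectorFields.
Variables (R : realType) (n : nat) (M : atlas R n).
Hypothesis HM : smooth_atlas M.
Hypothesis Hausdorff : hausdorff_manifold M.
Implicit Types (i j k : chart M) (x y : M) (f g : M -> R) (W : set M).

(** Compact sets are closed in a Hausdorff space, for a compact set given inside
    one chart.  The near-covering form of compactness is used with the filter of
    open neighbourhoods of a point [y] outside: each point of the compact set has
    a neighbourhood disjoint from some neighbourhood of [y], and compactness makes
    the latter uniform. *)
Lemma mopen_compactC i (B : set 'rV[R]_n) : compact B ->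
  B `<=` chart_image i setT -> mopen (~` [set y | dom i y /\ B (coord i y)]).
Proof.
move=> /compact_near_coveringP cB Bi j; rewrite openE => _ [y [jy yB] <-].
pose F : set_system M := fun A => exists N, [/\ mopen N, N y & N `<=` A].
have FF : Filter F.
  split.
  - by exists setT; split => //; exact: mopenT HM.
  - move=> A A' [N [oN Ny NA]] [N' [oN' Ny' NA']]; exists (N `&` N'); split => //.
      exact: mopenI HM _ _ oN oN'.
    by move=> z [/NA ? /NA' ?].
  - by move=> A A' AA' [N [oN Ny NA]]; exists N; split => // z /NA /AA'.
have [|N [oN Ny NB]] := cB _ F (fun y' p => ~ (dom i y' /\ coord i y' = p)) FF.
  move=> p Bp; have [k [ik _] kp] := Bi p Bp.
  have ky : k <> y by move=> E; apply: yB; rewrite -E /= kp.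
  have [A [N [oA oN Ak Ny AN]]] := Hausdorff ky.
  exists (chart_image i A, N) => /=.
    split; first by rewrite -kp; exact: mopen_nbhs oA ik Ak.
    by exists N; split.
  move=> [_ y'] /= [[a [ia Aa] <-] Ny'] [iy' E].
  have := sa_inj HM iy' ia E => y'a; subst y'.
  by have : (A `&` N) a by []; rewrite AN.
apply: filterS (mopen_nbhs oN jy Ny) => _ [z [jz Nz] <-].
exists z => //; split => // -[iz Bz].
exact: NB z Nz _ Bz (conj iz erefl).
Qed.

(** The field with constant components in chart [i], cut off and written in
    chart [j]. *)
Definition bump_field i (c v : 'rV[R]_n) (r : R) : row_field M := fun j y =>
  (if `[< dom i y >] then radial_bump c r (coord i y) else 0) *: (v *m (jac i j y)^T).

(** The overlap with chart [i] and the complement of the support cover every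
    chart; the field is smooth on the first by change of chart and zero on the
    second, which is open because the support is compact. *)
Lemma bump_field_vector i c v r : 0 < r ->
  (forall p, `|p - c| <= r -> chart_image i setT p) ->
  is_vector_field (bump_field i c v r).
Proof.
move=> r0 ri.
have cB : compact [set p : 'rV[R]_n | `|p - c| <= r].
  apply: bounded_closed_compact.
    exists (`|c| + r); split; first exact: num_real.
    move=> t ct p /= pc; apply: (le_trans _ (ltW ct)).
    by rewrite -[p](subrKC c) (le_trans (ler_normD _ _))// lerD.
  rewrite (_ : [set p | _] = (fun p : 'rV[R]_n => `|p - c|) @^-1` [set t | t <= r]).
    apply: closed_comp; last exact: closed_le.
    move=> p _; apply: (@continuous_comp _ _ _ (fun q : 'rV[R]_n => q - c)).
      apply: continuousB; [exact: cvg_id|exact: cst_continuous].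
    exact: norm_continuous.
  by [].
have oC := mopen_compactC cB ri.
split=> [j a|j k y jy ky].
  move=> l; apply: Ck_local => _ [y [jy _] <-].
  have [iy|niy] := pselect (dom i y).
    exists (chart_image j (dom i `&` dom j)); first by exists y.
    have oij := mopenI HM (mopen_dom HM i) (mopen_dom HM j).
    apply: (smooth_within_eq HM (f := fun z => radial_bump c r (coord i z) *
      (\sum_b v 0 b * jac i j z a b)) oij).
      move=> z _ [iz _]; rewrite mxE /bump_field asboolT//; congr (_ * _).
      by rewrite mxE; apply: eq_bigr => b _; rewrite [in RHS]mxE.
    apply: smooth_within_mul => //.
      apply: (@smooth_within_change _ _ _ HM j i _ _ oij (fun z ij => proj1 ij)).
      move=> k; apply: (@Ck_eq _ _ _ _ (radial_bump c r)); first exact: oij.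
        by move=> _ [z [iz _] <-]; rewrite (readE HM).
      by apply: Ck_sub (smooth_bump c r k).
    apply: smooth_within_sum => // b; apply: smooth_within_mul => //.
      exact: smooth_within_cst.
    exact: smooth_within_jac.
  exists (chart_image j (~` [set y | dom i y /\ `|coord i y - c| <= r])).
    by exists y => //; split => // -[].
  apply: (smooth_within_eq HM (f := fun=> 0) oC).
    move=> z _ zC; rewrite mxE; case: asboolP => iz; last by rewrite mul0r.
    by rewrite bump_outside ?mul0r// => le; apply: zC.
  exact: (smooth_within_cst HM).
rewrite /bump_field -scalemxAl; case: asboolP => iy; last by rewrite !scale0r.
by rewrite -mulmxA -trmx_mul (jac_comp HM).
Qed.

Lemma vector_field_through i x (v : 'rV[R]_n) : dom i x ->
  exists2 X : row_field M, is_vector_field X & X i x = v.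
Proof.
move=> ix; set c := coord i x.
have /nbhs_ballP[e /= e0 ei] := mopen_nbhs (mopenT HM) ix I.
have e20 : 0 < e / 2 by rewrite divr_gt0.
(* The cut-off divides by its value at [c] to give exactly [v] there. *)
exists (bump_field i c ((radial_bump c (e / 2) c)^-1 *: v) (e / 2)).
  apply: bump_field_vector => // p pc; apply: ei.
  rewrite -ball_normE /ball_ /= distrC; apply: le_lt_trans pc _.
  by rewrite ltr_pdivrMr// ltr_pMr// ltr1n.
rewrite /bump_field asboolT// (jac_id HM)// trmx1 mulmx1 scalerA divff ?scale1r//.
exact: bump_center.
Qed.

End VectorFields.

(** * The tangent bundle as a manifold *)

Section Tangent.
Variables (R : realType) (n : nat) (Q : atlas R n).
Hypothesis HQ : smooth_manifold Q.
Local Notation TQ := (tangent_bundle Q).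
Implicit Types (i j k : chart Q) (x y : Q) (z : TQ).

Lemma smooth_manifold_atlas : smooth_atlas Q.
Proof. by case: HQ => *; split. Qed.
Local Notation aQ := smooth_manifold_atlas.

Lemma tangent_vector_eq i (z z' : tangent_vector Q) : foot z = foot z' ->
  dom i (foot z) -> tcomp z i = tcomp z' i -> z = z'.
Proof.
case: z z' => [x c ct co] [x' c' ct' co'] /= xx'; subst x' => ix ci.
have cc : c = c'.
  apply/funext => j; have [jx|njx] := pselect (dom j x).
    by rewrite (ct i j ix jx) ci -ct'.
  by rewrite co// co'.
by subst c'; congr TangentVector; exact: Prop_irrelevance.
Qed.

(** The transformation law of the components is the cocycle identity of the
    Jacobians. *)
Lemma tangent_vector_exists i x (u : 'rV[R]_n) : dom i x ->
  exists z : TQ, foot z = x /\ tcomp z i = u.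
Proof.
move=> ix; pose c j := if `[< dom j x >] then u *m (jac i j x)^T else 0.
have ct j k : dom j x -> dom k x -> c k = c j *m (jac j k x)^T.
  move=> jx kx; rewrite /c !asboolT// -mulmxA -trmx_mul.
  by rewrite (jac_comp aQ).
have co j : ~ dom j x -> c j = 0 by move=> jx; rewrite /c asboolF.
exists (TangentVector ct co); split => //=.
by rewrite /c asboolT// (jac_id aQ)// trmx1 mulmx1.
Qed.

Lemma tangent_chart_image i (W : set Q) :
  @chart_image _ _ TQ i [set z | W (foot z)] =
  lsubmx @^-1` chart_image i W.
Proof.
apply/seteqP; split=> [_ [z [/= iz Wz] <-]|p [x [ix Wx] xp]].
  by exists (foot z) => //=; rewrite row_mxKl.
have [z [zx zu]] := tangent_vector_exists (rsubmx p) ix.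
exists z; first by rewrite /= zx.
by rewrite /= zx zu xp hsubmxK.
Qed.

Lemma open_lsubmx (O : set 'rV[R]_n) : open O ->
  open ((lsubmx : 'rV[R]_(n + n) -> 'rV[R]_n) @^-1` O).
Proof. by move=> oO; apply: open_comp => // p _; exact: continuous_lsubmx. Qed.

Lemma mopen_foot (W : set Q) : mopen W -> @mopen _ _ TQ [set z | W (foot z)].
Proof. by move=> oW i; rewrite tangent_chart_image; exact/open_lsubmx/oW. Qed.

Lemma tangent_coord_inj i z z' : dom i (foot z) -> dom i (foot z') ->
  @coord _ _ TQ i z = @coord _ _ TQ i z' -> z = z'.
Proof.
move=> iz iz' /eq_row_mx[xx' uu']; apply: (@tangent_vector_eq i) => //.
exact: (sa_inj aQ) xx'.
Qed.

Lemma Ck_lsubmx (k : nat) (O : set 'rV[R]_n) (f : 'rV[R]_n -> R) : open O -> Ck k O f ->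
  Ck k ((lsubmx : 'rV[R]_(n + n) -> 'rV[R]_n) @^-1` O) (fun p => f (lsubmx p)).
Proof.
move=> oO fO; apply: (Ck_comp (V := O)) => //; first exact: open_lsubmx.
move=> b l; have := Ck_coord l (lshift n b) (open_lsubmx oO).
by apply: Ck_eq => [|p _]; [exact: open_lsubmx|rewrite mxE].
Qed.

(** The velocities transform with the Jacobian of the transition map of Q, so
    the transition map of TQ is (q, u) |-> (tau q, u (jac q)^T). *)
Lemma tangent_transition_smooth i j (c : 'I_(n + n)) :
  smooth_on (@chart_image _ _ TQ i (@dom _ _ TQ j))
    (@read _ _ TQ i (fun z => @coord _ _ TQ j z 0 c)).
Proof.
move=> k.
have rE f z : dom i (foot z) -> @read _ _ TQ i f (@coord _ _ TQ i z) = f z.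
  move=> iz; apply: read_coord => // z' iz'.
  exact: tangent_coord_inj.
pose O := chart_image i (dom j).
have cO : @chart_image _ _ TQ i (@dom _ _ TQ j) = lsubmx @^-1` O.
  exact: tangent_chart_image.
have oO : open O by exact: (mopen_dom aQ j).
have oO2 := open_lsubmx oO.
case: (split_ordP c) => b ->{c}; rewrite cO.
  apply: (@Ck_eq _ _ _ _ (fun p => transition i j (lsubmx p) 0 b)) => //.
    rewrite -cO => _ [z [iz jz] <-]; rewrite rE// /= row_mxKl row_mxEl.
    by rewrite (transitionE aQ).
  apply: (@Ck_lsubmx _ _ (fun q => transition i j q 0 b)) => //.
  exact: (smooth_transition aQ).
apply: (@Ck_eq _ _ _ _ (fun p => \sum_a p 0 (rshift n a) *
    read i (fun x => jac i j x b a) (lsubmx p))) => //.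
  rewrite -cO => _ [z [iz jz] <-]; rewrite rE// /= row_mxKl row_mxEr.
  rewrite (tcomp_transform iz jz) mxE; apply: eq_bigr => a _.
  by rewrite row_mxEr (readE aQ)// [in RHS]mxE.
apply: Ck_sum => // a; apply: Ck_mul => //; first exact: Ck_coord.
apply: (@Ck_lsubmx _ _ (read i (fun x => jac i j x b a))) => //.
have jk := smooth_within_jac aQ i j i b a k.
apply: Ck_sub jk.
by move=> _ [x [ix jx] <-]; exists x.
Qed.

Lemma tangent_atlas : smooth_atlas TQ.
Proof.
split=> [i z z'|i j|i j c]; first exact: tangent_coord_inj.
  exact: (mopen_foot (mopen_dom aQ j)).
exact: tangent_transition_smooth.
Qed.

(** Vectors at different points are separated by open sets of Q, vectors at the
    same point by open sets of one chart. *)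
Lemma tangent_hausdorff : hausdorff_manifold TQ.
Proof.
move=> z z' zz'; have [xx'|] := pselect (foot z = foot z'); last first.
  move=> /(manifold_hausdorff HQ)[A [B [oA oB Az Bz' AB]]].
  exists [set t | A (foot t)], [set t | B (foot t)]; split => //.
  - exact: mopen_foot.
  - exact: mopen_foot.
  - apply/seteqP; split=> // t [/= At Bt].
    by have : (A `&` B) (foot t) by []; rewrite AB.
have [i iz] := charts_cover HQ (foot z).
have iz' : dom i (foot z') by rewrite -xx'.
have cc : @coord _ _ TQ i z != @coord _ _ TQ i z'.
  by apply/eqP => /(tangent_coord_inj iz iz').
have := @norm_hausdorff R 'rV[R]_(n + n); rewrite open_hausdorff => /(_ _ _ cc).
case=> -[A B] /= [Az Bz'] [oA oB /eqP/seteqP[AB _]].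
exists [set t | @dom _ _ TQ i t /\ A (@coord _ _ TQ i t)].
exists [set t | @dom _ _ TQ i t /\ B (@coord _ _ TQ i t)].
split.
- exact: (mopen_preimage tangent_atlas).
- exact: (mopen_preimage tangent_atlas).
- by split => //; move: Az; rewrite inE.
- by split => //; move: Bz'; rewrite inE.
- apply/seteqP; split=> // t [/= [_ At] [_ Bt]].
  exact: AB _ (conj At Bt).
Qed.

Lemma smooth_within_foot i (W : set Q) f : mopen W -> smooth_within i W f ->
  @smooth_within _ _ TQ i [set z | W (foot z)] (fun z => f (foot z)).
Proof.
move=> oW fW k; rewrite tangent_chart_image.
apply: (@Ck_eq _ _ _ _ (fun p => read i f (lsubmx p))).
- exact: open_lsubmx.
- rewrite -tangent_chart_image => _ [z [iz Wz] <-].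
  by rewrite (readE tangent_atlas)//= row_mxKl (readE aQ).
- exact: Ck_lsubmx.
Qed.

Lemma pd_foot i f c z : smooth_in i f -> dom i (foot z) ->
  @pd _ _ TQ i c (fun z => f (foot z)) z =
  \sum_b pd i b f (foot z) * (delta_mx 0 c : 'rV[R]_(n + n)) 0 (lshift n b).
Proof.
move=> fi iz; set v : 'rV[R]_(n + n) := delta_mx 0 c.
transitivity ('D_v (fun p => read i f (lsubmx p)) (@coord _ _ TQ i z)).
  apply: near_eq_derive.
  apply: filterS (mopen_nbhs (mopenT tangent_atlas) iz I) => _ [t [it _] <-].
  by rewrite (readE tangent_atlas)//= row_mxKl (readE aQ).
have cE b : (fun p : 'rV[R]_(n + n) => (lsubmx p : 'rV[R]_n) 0 b) =
    (fun p => p 0 (lshift n b)).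
  by apply/funext => p; rewrite mxE.
rewrite derive_comp.
- rewrite /= row_mxKl; apply: eq_bigr => b _; rewrite /pd; congr (_ * _).
  by rewrite cE derive_coord.
- by move=> b; rewrite cE; exact: differentiable_coord.
- by rewrite /= row_mxKl; exact: (read_diff (mopenT aQ) fi iz I).
Qed.

Lemma pd_foot_l i f a z : smooth_in i f -> dom i (foot z) ->
  @pd _ _ TQ i (lshift n a) (fun z => f (foot z)) z = pd i a f (foot z).
Proof.
move=> fi iz; rewrite pd_foot// (bigD1 a)//= mxE !eqxx mulr1 big1 ?addr0// => b ba.
by rewrite mxE (inj_eq (@lshift_inj _ _)) (negbTE ba) mulr0.
Qed.

Lemma pd_foot_r i f a z : smooth_in i f -> dom i (foot z) ->
  @pd _ _ TQ i (rshift n a) (fun z => f (foot z)) z = 0.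
Proof.
by move=> fi iz; rewrite pd_foot// big1// => b _; rewrite mxE eq_lrshift mulr0.
Qed.

End Tangent.

(** * The linear algebra of recursion operators *)

(** The linear algebra of a recursion operator at one point.  [W0] and [W1] stand
    for the values of two 2-forms, [A] for the operator, and [D0], [D1], [D2],
    [DA] for the directional derivatives of [W0], [W1], [W2 = A W1] and [A]; the
    hypotheses are the differentiated relations [A W0 = W1] and [A W1 = W2].  In
    the torsion contracted with [W0] they remove all derivatives of [A], and the
    closedness of the forms cancels what is left.  Paired through [W0] with a vector
    [e], the torsion is the cyclic sum of [D2] up to sign, once [D2 e] has been
    expressed by [D0 e] and [D1 e] ([D2A]). *)
Lemma magri_algebra (R : realFieldType) n (A W0 W1 : 'M[R]_n)
    (DA D0 D1 D2 : 'rV[R]_n -> 'M[R]_n) v w :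
  W0^T = - W0 -> W1^T = - W1 -> A *m W0 = W1 ->
  (forall u, (D0 u)^T = - D0 u) -> (forall u, (D1 u)^T = - D1 u) ->
  (forall u, (D2 u)^T = - D2 u) ->
  (forall u, DA u *m W0 + A *m D0 u = D1 u) ->
  (forall u, DA u *m W1 + A *m D1 u = D2 u) ->
  let closed (D : 'rV[R]_n -> 'M[R]_n) := forall u1 u2 u3,
    (u2 *m D u1 *m u3^T) 0 0 + (u3 *m D u2 *m u1^T) 0 0 +
    (u1 *m D u3 *m u2^T) 0 0 = 0 in
  closed D0 -> closed D1 -> closed D2 ->
  (w *m DA (v *m A) - v *m DA (w *m A) + v *m DA w *m A - w *m DA v *m A)
    *m W0 = 0.
Proof.
move=> skW0 skW1 AW sk0 sk1 sk2 E1 E2 closed cl0 cl1 cl2.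
have D1E u : DA u *m W0 = D1 u - A *m D0 u by rewrite -E1 addrK.
have D2E u : DA u *m W1 = D2 u - A *m D1 u by rewrite -E2 addrK.
have WDA u : W0 *m (DA u)^T = D1 u - D0 u *m A^T.
  apply: oppr_inj; rewrite -mulNmx -skW0 -trmx_mul D1E.
  by rewrite linearB /= trmx_mul sk0 sk1 mulNmx opprB opprK addrC.
have W1DA u : W1 *m (DA u)^T = D2 u - D1 u *m A^T.
  apply: oppr_inj; rewrite -mulNmx -skW1 -trmx_mul D2E.
  by rewrite linearB /= trmx_mul sk1 sk2 mulNmx opprB opprK addrC.
have D2A u : D2 u = A *m D1 u + D1 u *m A^T - A *m D0 u *m A^T.
  rewrite -[LHS](subrK (D1 u *m A^T)) -W1DA -AW -mulmxA WDA mulmxBr mulmxA.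
  by rewrite addrAC.
apply/rowP => a; rewrite [RHS]mxE.
pose e : 'rV[R]_n := delta_mx 0 a.
have eE (X : 'rV[R]_n) : X 0 a = (X *m e^T) 0 0.
  by rewrite /e trmx_delta -colE !mxE.
pose s (W : 'M[R]_n) (u1 u2 : 'rV[R]_n) := (u1 *m W *m u2^T) 0 0.
have sE (W : 'M[R]_n) (u1 u2 : 'rV[R]_n) : (u1 *m W *m u2^T) 0 0 = s W u1 u2 by [].
have mD (X Y : 'M[R]_1) : (X + Y) 0 0 = X 0 0 + Y 0 0 by rewrite !mxE.
have mN (X : 'M[R]_1) : (- X) 0 0 = - X 0 0 by rewrite !mxE.
have sk (W : 'M[R]_n) (u1 u2 : 'rV[R]_n) : W^T = - W -> s W u1 u2 = - s W u2 u1.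
  move=> Wsk; rewrite -mN /s -mulNmx -mulmxN -Wsk -[u2]trmxK -!trmx_mul.
  by rewrite !trmxK mulmxA [RHS]mxE.
rewrite eE !mulmxBl mulmxDl mulmxBl -!(mulmxA _ _ W0) AW -!(mulmxA _ _ W1).
rewrite !D1E !D2E !mulmxBr !mulmxA !(mulmxDl, mulNmx, mD, mN, sE).
move: (D2A e) => /(congr1 (fun W => s W v w)).
have tr_mul (u1 u2 : 'rV[R]_n) (W : 'M[R]_n) : u1 *m W *m A^T *m u2^T =
   u1 *m W *m (u2 *m A)^T by rewrite trmx_mul !mulmxA.
rewrite {2}/s !(mulmxDr, mulmxDl, mulmxN, mulNmx, mD, mN) !mulmxA.
rewrite !tr_mul !sE.
have := cl0 (v *m A) (w *m A) e; have := cl1 (v *m A) w e.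
have := cl1 (w *m A) v e; have := cl2 v w e; rewrite !sE.
rewrite (sk _ e v (sk2 w)) (sk _ e _ (sk1 v)) (sk _ e _ (sk1 w)).
rewrite (sk _ (w *m A) v (sk1 e)) (sk _ e _ (sk0 (w *m A))).
lra.
Qed.

(** * Directional derivatives of matrices and the torsion at a point *)

(** For identities of the additive group generated by the matrix products that
    occur in them. *)
Ltac abelian_by_entries :=
  repeat match goal with
  | |- context [@mulmx ?R ?m ?n ?p ?X ?Y] =>
    let t := fresh "t" in set t := (@mulmx R m n p X Y); clearbody t
  end; apply/matrixP => ? ?; rewrite !mxE; ring.

Section Derivation.
Variables (R : realType) (n : nat) (M : atlas R n).
Hypothesis HM : smooth_atlas M.
Variable i : chart M.
Implicit Types (x y : M) (u v w : 'rV[R]_n).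
Local Notation oT := (mopenT HM).

Definition smooth_mx p q (F : M -> 'M[R]_(p, q)) :=
  forall a b, smooth_in i (fun x => F x a b).

(** The directional derivative of a matrix-valued function along the constant
    field with components [u]; it turns tensor computations in a chart into matrix
    algebra. *)
Definition dmx p q u (F : M -> 'M[R]_(p, q)) x : 'M[R]_(p, q) :=
  \matrix_(a, b) \sum_c u 0 c * pd i c (fun y => F y a b) x.

Lemma smooth_mx_mul p q r (F : M -> 'M[R]_(p, q)) (G : M -> 'M[R]_(q, r)) :
  smooth_mx F -> smooth_mx G -> smooth_mx (fun y => F y *m G y).
Proof.
move=> sF sG a b; apply: (smooth_within_eq HM
  (f := fun x => \sum_c F x a c * G x c b) oT) => [x _ _|]; first by rewrite mxE.
apply: (smooth_within_sum HM _ oT) => c.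
exact: (smooth_within_mul HM oT (sF a c) (sG c b)).
Qed.

Lemma smooth_mx_tr p q (F : M -> 'M[R]_(p, q)) :
  smooth_mx F -> smooth_mx (fun y => (F y)^T).
Proof.
move=> sF a b; apply: (smooth_within_eq HM (f := fun x => F x b a) oT) => [x _ _|].
  by rewrite mxE.
exact: sF.
Qed.

Lemma smooth_mx_dmx p q u (F : M -> 'M[R]_(p, q)) :
  smooth_mx F -> smooth_mx (dmx u F).
Proof.
move=> sF a b; apply: (smooth_within_eq HM
  (f := fun x => \sum_c u 0 c * pd i c (fun y => F y a b) x) oT) => [x _ _|].
  by rewrite mxE.
apply: (smooth_within_sum HM _ oT) => c; apply: (smooth_within_mul HM oT).
  exact: (smooth_within_cst HM i _ oT).
exact: (smooth_within_pd HM _ oT (sF _ _)).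
Qed.

Lemma dmx_eq p q u (F G : M -> 'M[R]_(p, q)) x : dom i x ->
  (forall y, dom i y -> F y = G y) -> dmx u F x = dmx u G x.
Proof.
move=> ix FG; apply/matrixP => a b; rewrite !mxE; apply: eq_bigr => c _.
by rewrite (pd_eq HM (g := fun y => G y a b) c oT _ ix I)// => y iy _; rewrite FG.
Qed.

Lemma dmx_tr p q u (F : M -> 'M[R]_(p, q)) x :
  dmx u (fun y => (F y)^T) x = (dmx u F x)^T.
Proof.
apply/matrixP => a b; rewrite !mxE; apply: eq_bigr => c _.
have -> : (fun y => (F y)^T a b) = (fun y => F y b a).
  by apply/funext => y; rewrite mxE.
by [].
Qed.

Lemma dmx_cst p q u (C : 'M[R]_(p, q)) x : dom i x -> dmx u (fun=> C) x = 0.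
Proof.
move=> ix; apply/matrixP => a b; rewrite !mxE; apply: big1 => c _.
by rewrite (pd_cst HM (C a b) c ix) mulr0.
Qed.

Lemma dmx_add p q u (F G : M -> 'M[R]_(p, q)) x : dom i x ->
  smooth_mx F -> smooth_mx G ->
  dmx u (fun y => F y + G y) x = dmx u F x + dmx u G x.
Proof.
move=> ix sF sG; apply/matrixP => a b; rewrite !mxE -big_split /=; apply: eq_bigr => c _.
rewrite -mulrDr -(pd_add HM c oT (sF a b) (sG a b) ix I); congr (_ * _).
by apply: (pd_eq HM c oT _ ix I) => y _ _; rewrite mxE.
Qed.

Lemma dmx_mul p q r u (F : M -> 'M[R]_(p, q)) (G : M -> 'M[R]_(q, r)) x :
  dom i x -> smooth_mx F -> smooth_mx G ->
  dmx u (fun y => F y *m G y) x = dmx u F x *m G x + F x *m dmx u G x.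
Proof.
move=> ix sF sG; apply/matrixP => a b; rewrite !mxE.
transitivity (\sum_c u 0 c * \sum_d (pd i c (fun y => F y a d) x * G x d b +
   F x a d * pd i c (fun y => G y d b) x)).
  apply: eq_bigr => c _; congr (_ * _).
  transitivity (pd i c (fun y => \sum_d F y a d * G y d b) x).
    by apply: (pd_eq HM c oT _ ix I) => y _ _; rewrite mxE.
  rewrite (pd_sum HM _ _ oT _ ix I) => [|d].
    by apply: eq_bigr => d _; exact: (pd_mul HM c oT (sF a d) (sG d b) ix I).
  exact: (smooth_within_mul HM oT (sF a d) (sG d b)).
transitivity (\sum_d \sum_c (u 0 c * pd i c (fun y => F y a d) x * G x d b +
   F x a d * (u 0 c * pd i c (fun y => G y d b) x))).
  rewrite exchange_big; apply: eq_bigr => c _; rewrite mulr_sumr.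
  by apply: eq_bigr => d _; rewrite mulrDr mulrA (mulrCA (u 0 c)).
rewrite -big_split; apply: eq_bigr => d _.
by rewrite !mxE big_split /= mulr_suml mulr_sumr.
Qed.

Lemma smooth_mx_cst p q (C : 'M[R]_(p, q)) : smooth_mx (fun=> C).
Proof. by move=> a b; exact: (smooth_within_cst HM i _ oT). Qed.

Lemma dmx_opp p q u (F : M -> 'M[R]_(p, q)) x : dom i x -> smooth_mx F ->
  dmx u (fun y => - F y) x = - dmx u F x.
Proof.
move=> ix sF; rewrite (dmx_eq u (G := fun y => F y *m (-1)%:M) ix) => [|y _].
  rewrite (dmx_mul _ ix sF (smooth_mx_cst _)) dmx_cst// mulmx0 addr0.
  by rewrite mul_mx_scalar scaleN1r.
by rewrite mul_mx_scalar scaleN1r.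
Qed.

Lemma dmx_sandwich p q r s u (B : 'M[R]_(p, q)) (F : M -> 'M[R]_(q, r))
    (C : 'M[R]_(r, s)) x : dom i x -> smooth_mx F ->
  dmx u (fun y => B *m F y *m C) x = B *m dmx u F x *m C.
Proof.
have sc := smooth_mx_cst.
move=> ix sF; rewrite dmx_mul//; last exact: smooth_mx_mul.
by rewrite dmx_mul// !dmx_cst// mul0mx add0r mulmx0 addr0.
Qed.

Lemma dmx_swap p q u v (F : M -> 'M[R]_(p, q)) x : dom i x -> smooth_mx F ->
  dmx u (dmx v F) x = dmx v (dmx u F) x.
Proof.
move=> ix sF; apply/matrixP => a b; rewrite !mxE.
have E u' v' : \sum_c u' 0 c * pd i c (fun y => dmx v' F y a b) x =
    \sum_c \sum_d u' 0 c * v' 0 d * pd i c (pd i d (fun y => F y a b)) x.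
  apply: eq_bigr => c _; under eq_bigr do rewrite -mulrA; rewrite -mulr_sumr.
  congr (_ * _).
  transitivity (pd i c (fun y => \sum_d v' 0 d * pd i d (fun y => F y a b) y) x).
    by apply: (pd_eq HM c oT _ ix I) => y _ _; rewrite mxE.
  have sd d := smooth_within_pd HM d oT (sF a b).
  have sv d := smooth_within_cst HM i (v' 0 d) oT.
  rewrite (pd_sum HM _ _ oT _ ix I) => [|d].
    apply: eq_bigr => d _; rewrite (pd_mul HM c oT (sv d) (sd d) ix I).
    by rewrite (pd_cst HM)// mul0r add0r.
  exact: (smooth_within_mul HM oT (sv d) (sd d)).
rewrite !E exchange_big; apply: eq_bigr => c _; apply: eq_bigr => d _.
by rewrite (pd_swap HM d c oT (sF a b) ix I) (mulrC (u 0 d)).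
Qed.

(** The exterior derivative of the 2-form with skew matrix [W] vanishes at [x]. *)
Definition closed_form (W : M -> 'M[R]_n) x := forall u v w,
  (v *m dmx u W x *m w^T) 0 0 + (w *m dmx v W x *m u^T) 0 0 +
  (u *m dmx w W x *m v^T) 0 0 = 0.

Lemma diff1_dmx (th : row_field M) v w x :
  v *m diff1 th i x *m w^T =
  dmx v (th i) x *m w^T - dmx w (th i) x *m v^T.
Proof.
apply/matrixP => a b; rewrite !ord1 !mxE.
transitivity (\sum_c \sum_d (v 0 d * pd i d (fun y => th i y 0 c) x * w 0 c -
    v 0 d * pd i c (fun y => th i y 0 d) x * w 0 c)).
  apply: eq_bigr => c _; rewrite !mxE mulr_suml; apply: eq_bigr => d _.
  by rewrite mxE mulrBr mulrBl.
under eq_bigr do rewrite sumrB; rewrite sumrB; congr (_ - _).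
  by apply: eq_bigr => c _; rewrite !mxE mulr_suml.
rewrite exchange_big; apply: eq_bigr => d _; rewrite !mxE mulr_suml.
by apply: eq_bigr => c _; rewrite [LHS]mulrC (mulrC (v 0 d)) mulrA.
Qed.

Lemma smooth_diff1 (th : row_field M) : smooth_mx (th i) -> smooth_mx (diff1 th i).
Proof.
move=> st a b; apply: (smooth_within_eq HM (f := fun x =>
  pd i a (fun y => th i y 0 b) x + (-1) * pd i b (fun y => th i y 0 a) x) oT).
  by move=> x _ _; rewrite mxE mulN1r.
apply: (smooth_within_add HM oT); first exact: (smooth_within_pd HM _ oT (st _ _)).
apply: (smooth_within_mul HM oT); first exact: (smooth_within_cst HM i _ oT).
exact: (smooth_within_pd HM _ oT (st _ _)).
Qed.

Lemma diff1_skew (th : row_field M) x : (diff1 th i x)^T = - diff1 th i x.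
Proof. by apply/matrixP => a b; rewrite !mxE opprB. Qed.

(** dd = 0: the cyclic sum consists of second derivatives of [th] that cancel in
    pairs by [dmx_swap]. *)
Lemma diff1_closed (th : row_field M) x : dom i x -> smooth_mx (th i) ->
  closed_form (diff1 th i) x.
Proof.
move=> ix st.
have sc := smooth_mx_cst.
have dE u v w : v *m dmx u (diff1 th i) x *m w^T =
    dmx u (dmx v (th i)) x *m w^T - dmx u (dmx w (th i)) x *m v^T.
  rewrite -dmx_sandwich//; last exact: smooth_diff1.
  rewrite (dmx_eq u (G := fun y => dmx v (th i) y *m w^T +
     dmx w (th i) y *m (- v^T)) ix) => [|y _]; last by rewrite diff1_dmx mulmxN.
  have sd v' := smooth_mx_dmx v' st.
  rewrite dmx_add//; [|exact: smooth_mx_mul|exact: smooth_mx_mul].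
  by rewrite !dmx_mul// !dmx_cst// !mulmx0 !addr0 mulmxN.
move=> u v w; rewrite !dE (dmx_swap u v)// (dmx_swap u w)// (dmx_swap v w)//.
have mB (X Y : 'M[R]_1) : (X - Y) 0 0 = X 0 0 - Y 0 0 by rewrite !mxE.
rewrite !mB; ring.
Qed.

(** The torsion evaluated on vectors at a point, for a tensor acting on rows by
    [A], the transpose of its component matrix. *)
Definition torsion_at (A : M -> 'M[R]_n) x v w : 'rV[R]_n :=
  w *m dmx (v *m A x) A x - v *m dmx (w *m A x) A x
  + v *m dmx w A x *m A x - w *m dmx v A x *m A x.

Lemma bracket_dmx (xi eta : row_field M) x :
  bracket xi eta i x = dmx (xi i x) (eta i) x - dmx (eta i x) (xi i) x.
Proof.
by apply/rowP => a; rewrite !mxE -sumrB; apply: eq_bigr => b _.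
Qed.

(** Tensoriality of the torsion: all derivatives of the two vector fields
    cancel. *)
Lemma nijenhuis_torsion_at (K : mx_field M) (xi eta : row_field M) x : dom i x ->
  smooth_mx (K i) -> smooth_mx (xi i) -> smooth_mx (eta i) ->
  nijenhuis K xi eta i x =
  torsion_at (fun y => (K i y)^T) x (xi i x) (eta i x).
Proof.
move=> ix sK sx se; have sA := smooth_mx_tr sK.
rewrite /nijenhuis !fctE /tapp !fctE !bracket_dmx /torsion_at.
set A := fun y => (K i y)^T.
rewrite -/(A x) !(dmx_mul _ ix)//.
rewrite -/A !(mulmxDl, mulNmx, opprD, opprK).
abelian_by_entries.
Qed.

(** If [W0], [W1 = A W0] and [W2 = A W1] are closed 2-forms, the torsion of the
    recursion operator vanishes up to the kernel of [W0]. *)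
Lemma magri_morosi (A W0 W1 W2 : M -> 'M[R]_n) x v w : dom i x ->
  smooth_mx A -> smooth_mx W0 -> smooth_mx W1 ->
  (forall y, dom i y -> (W0 y)^T = - W0 y) ->
  (forall y, dom i y -> (W1 y)^T = - W1 y) ->
  (forall y, dom i y -> (W2 y)^T = - W2 y) ->
  (forall y, dom i y -> A y *m W0 y = W1 y) ->
  (forall y, dom i y -> A y *m W1 y = W2 y) ->
  closed_form W0 x -> closed_form W1 x -> closed_form W2 x ->
  torsion_at A x v w *m W0 x = 0.
Proof.
move=> ix sA sW0 sW1 skew0 skew1 skew2 AW0 AW1 cl0 cl1 cl2.
have sW2 : smooth_mx W2.
  move=> a b; apply: (smooth_within_eq HM
    (f := fun x => (A x *m W1 x) a b) oT) => [y iy _|]; first by rewrite AW1.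
  exact: smooth_mx_mul.
have skewD (W : M -> 'M[R]_n) u : smooth_mx W ->
    (forall y, dom i y -> (W y)^T = - W y) -> (dmx u W x)^T = - dmx u W x.
  by move=> sW sk; rewrite -dmx_tr -dmx_opp//; exact: dmx_eq.
apply: (@magri_algebra R n (A x) (W0 x) (W1 x) (fun u => dmx u A x)
  (fun u => dmx u W0 x) (fun u => dmx u W1 x) (fun u => dmx u W2 x)).
- exact: skew0.
- exact: skew1.
- exact: AW0.
- by move=> u; exact: skewD.
- by move=> u; exact: skewD.
- by move=> u; exact: skewD.
- by move=> u; rewrite -dmx_mul//; exact: dmx_eq.
- by move=> u; rewrite -dmx_mul//; exact: dmx_eq.
- exact: cl0.
- exact: cl1.
- exact: cl2.
Qed.

End Derivation.

(** * The block structure of the recursion operator *)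

(** Vanishing on global fields is a pointwise condition because every vector is
    the value of a global field. *)
Lemma nijenhuis_vanishesP (R : realType) n (M : atlas R n) (K : mx_field M) :
  smooth_atlas M -> hausdorff_manifold M -> (forall i, smooth_mx i (K i)) ->
  nijenhuis_vanishes K <-> forall i x v w, dom i x ->
    torsion_at i (fun y => (K i y)^T) x v w = 0.
Proof.
move=> HM Hausdorff sK; split=> [N0 i x v w ix|N0 xi eta vx ve i x ix].
  have [xi vx <-] := vector_field_through HM Hausdorff v ix.
  have [eta ve <-] := vector_field_through HM Hausdorff w ix.
  rewrite -nijenhuis_torsion_at//.
  - exact: N0.
  - by move=> a b; rewrite (ord1 a); apply: vx.1.
  - by move=> a b; rewrite (ord1 a); apply: ve.1.
rewrite nijenhuis_torsion_at//.
- exact: N0.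
- by move=> a b; rewrite (ord1 a); apply: vx.1.
- by move=> a b; rewrite (ord1 a); apply: ve.1.
Qed.

Section Blocks.
Variables (R : fieldType) (n : nat).
Implicit Types (J G H E : 'M[R]_n).

Lemma eq_mx_rows m p (X Y : 'M[R]_(m, p)) :
  (forall v : 'rV_m, v *m X = v *m Y) -> X = Y.
Proof. by move=> XY; apply/row_matrixP => a; rewrite !rowE XY. Qed.

Lemma eq_mx_forms m p (X Y : 'M[R]_(m, p)) :
  (forall (v : 'rV_m) (w : 'rV_p), v *m X *m w^T = v *m Y *m w^T) -> X = Y.
Proof.
move=> XY; apply: eq_mx_rows => v; apply: trmx_inj; apply: eq_mx_rows => w.
by apply: trmx_inj; rewrite !trmx_mul !trmxK XY.
Qed.

(** The matrix of d(p_a dq^a) on TQ, when [G] and [H] are the derivatives of the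
    p_a along the q- and the u-directions. *)
Definition form_block G H : 'M[R]_(n + n) := block_mx (G - G^T) (- H^T) H 0.

Lemma form_block_unit G H : H \in unitmx -> form_block G H \in unitmx.
Proof.
move=> uH; pose B := block_mx 0 (invmx H) (- (invmx H)^T)
   ((invmx H)^T *m (G - G^T) *m invmx H).
suff /mulmx1_unit[] : form_block G H *m B = 1%:M by [].
rewrite mulmx_block !mulmx0 !mul0mx !add0r !addr0 mulmxN mulNmx opprK.
rewrite -trmx_mul mulVmx// trmx1 mulmxV// mulNmx !mulmxA -trmx_mul mulVmx//.
by rewrite trmx1 mul1mx subrr scalar_mx_block.
Qed.

(** The right half of the relation reads X H^T = J^T H^T and Z H^T = 0 for the
    left half (X, Z) of [A]. *)
Lemma recursion_blocks (A : 'M[R]_(n + n)) J G H E : H \in unitmx ->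
  A *m form_block G H = form_block (G *m J + E) (H *m J) ->
  ulsubmx A = J^T /\ dlsubmx A = 0.
Proof.
move=> uH; have uHT : H^T \in unitmx by rewrite unitmx_tr.
rewrite -{1}(submxK A) mulmx_block => /eq_block_mx[_ + _ +].
rewrite !mulmx0 !addr0 !mulmxN => /oppr_inj XH ZH; split.
  by rewrite -[LHS](mulmxK uHT) XH trmx_mul mulmxK.
by rewrite -[LHS](mulmxK uHT) -[_ *m H^T]opprK ZH oppr0 mul0mx.
Qed.

(** The operator applied twice to d(p_a dq^a) gives d(p_a (J^2)^a_b dq^b) as soon
    as the terms [E] and [E2], in which J and J^2 are differentiated, match. *)
Lemma recursion_square (A : 'M[R]_(n + n)) J G H E E2 : H \in unitmx ->
  A *m form_block G H = form_block (G *m J + E) (H *m J) ->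
  J^T *m (E - E^T) + (E - E^T) *m J = E2 - E2^T ->
  A *m form_block (G *m J + E) (H *m J) =
  form_block (G *m (J *m J) + E2) (H *m (J *m J)).
Proof.
move=> uH AO EE2; have [XA ZA] := recursion_blocks uH AO.
move: AO; rewrite -(submxK A) XA ZA.
move: (ursubmx A) (drsubmx A) => Y W.
rewrite !mulmx_block !mul0mx !mulmx0 !addr0 !add0r.
move=> /eq_block_mx[YH _ WH _]; rewrite !mulmxA WH /form_block.
congr block_mx; last by rewrite !trmx_mul mulmxN !mulmxA.
have -> : Y *m H = G *m J + E - (G *m J + E)^T - J^T *m (G - G^T).
  by rewrite -YH addrC addKr.
transitivity (G *m J *m J - (G *m J *m J)^T + (J^T *m (E - E^T) + (E - E^T) *m J)).
  have trD (X Z : 'M[R]_n) : (X + Z)^T = X^T + Z^T by exact: linearD.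
  rewrite !trD !(mulmxDl, mulmxBl, mulmxDr, mulmxN, mulNmx).
  rewrite !trmx_mul !mulmxA.
  by apply/matrixP => a b; rewrite !mxE; ring.
by rewrite EE2 linearD /= opprD addrACA !trmx_mul !mulmxA.
Qed.

End Blocks.

Section Geometry.
Variables (R : realType) (n : nat) (Q : atlas R n).
Hypothesis HQ : smooth_manifold Q.
Local Notation TQ := (tangent_bundle Q).
Local Notation aQ := (smooth_manifold_atlas HQ).
Local Notation aT := (tangent_atlas HQ).
Variable i : chart Q.
Implicit Types (x y : Q) (z t : TQ).

Definition base_jac (p : TQ -> 'rV[R]_n) z : 'M[R]_n :=
  \matrix_(a, b) @pd _ _ TQ i (lshift n a) (fun t => p t 0 b) z.

Definition fibre_jac (p : TQ -> 'rV[R]_n) z : 'M[R]_n :=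
  \matrix_(a, b) @pd _ _ TQ i (rshift n a) (fun t => p t 0 b) z.

Lemma diff1_horizontal (th : row_field TQ) (p : TQ -> 'rV[R]_n) z :
  (forall t : TQ, dom i (foot t) -> th i t = row_mx (p t) 0) -> dom i (foot z) ->
  diff1 th i z = form_block (base_jac p z) (fibre_jac p z).
Proof.
move=> thp iz.
have pl c b : @pd _ _ TQ i c (fun t => th i t 0 (lshift n b)) z =
    @pd _ _ TQ i c (fun t => p t 0 b) z.
  by apply: (pd_eq aT c (mopenT aT) _ iz I) => t it _; rewrite thp// row_mxEl.
have pr c b : @pd _ _ TQ i c (fun t => th i t 0 (rshift n b)) z = 0.
  rewrite -[RHS](pd_cst aT 0 c iz).
  by apply: (pd_eq aT c (mopenT aT) _ iz I) => t it _; rewrite thp// row_mxEr mxE.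
apply/matrixP => a b; rewrite mxE.
case: (split_ordP a) => a' ->; case: (split_ordP b) => b' ->;
  rewrite ?(block_mxEul, block_mxEur, block_mxEdl, block_mxEdr) ?pl ?pr !mxE.
- by [].
- by rewrite sub0r.
- by rewrite subr0.
- by rewrite subr0.
Qed.

(** The part of d/dq^a (p_d F^d_b) in which F is differentiated. *)
Definition defect (F : Q -> 'M[R]_n) (p : 'rV[R]_n) x : 'M[R]_n :=
  \matrix_(a, b) \sum_d p 0 d * pd i a (fun y => F y d b) x.

Lemma defect_dmx F (p v : 'rV[R]_n) x : v *m defect F p x = p *m dmx i v F x.
Proof.
apply/rowP => b; rewrite !mxE.
transitivity (\sum_a \sum_d v 0 a * (p 0 d * pd i a (fun y => F y d b) x)).
  by apply: eq_bigr => a _; rewrite mxE mulr_sumr.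
rewrite exchange_big; apply: eq_bigr => d _; rewrite mxE mulr_sumr.
by apply: eq_bigr => a _; rewrite mulrCA.
Qed.

Lemma smooth_mx_foot p q (F : Q -> 'M[R]_(p, q)) : smooth_mx i F ->
  @smooth_mx _ _ TQ i _ _ (fun z => F (foot z)).
Proof. by move=> sF a b; exact: (smooth_within_foot HQ (mopenT aQ) (sF a b)). Qed.

Section Momentum.
Variables (p : TQ -> 'rV[R]_n) (F : Q -> 'M[R]_n) (z : TQ).
Hypotheses (sp : @smooth_mx _ _ TQ i _ _ p) (sF : smooth_mx i F).
Hypothesis iz : dom i (foot z).

Let pd_mulF c b : @pd _ _ TQ i c (fun t => (p t *m F (foot t)) 0 b) z =
  \sum_d (@pd _ _ TQ i c (fun t => p t 0 d) z * F (foot z) d b +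
    p z 0 d * @pd _ _ TQ i c (fun t => F (foot t) d b) z).
Proof.
have sFz := smooth_mx_foot sF.
transitivity (@pd _ _ TQ i c (fun t => \sum_d p t 0 d * F (foot t) d b) z).
  by apply: (pd_eq aT c (mopenT aT) _ iz I) => t it _; rewrite mxE.
rewrite (pd_sum aT _ _ (mopenT aT) _ iz I) => [|d].
  by apply: eq_bigr => d _; exact: (pd_mul aT c (mopenT aT) (sp 0 d) (sFz d b) iz I).
exact: (smooth_within_mul aT (mopenT aT) (sp 0 d) (sFz d b)).
Qed.

Lemma base_jac_mul : base_jac (fun t => p t *m F (foot t)) z =
  base_jac p z *m F (foot z) + defect F (p z) (foot z).
Proof.
apply/matrixP => a b; rewrite !mxE pd_mulF big_split /=; congr (_ + _).
  by apply: eq_bigr => d _; rewrite mxE.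
by apply: eq_bigr => d _; rewrite (pd_foot_l HQ a (sF d b)).
Qed.

Lemma fibre_jac_mul : fibre_jac (fun t => p t *m F (foot t)) z =
  fibre_jac p z *m F (foot z).
Proof.
apply/matrixP => a b; rewrite !mxE pd_mulF; apply: eq_bigr => d _.
by rewrite mxE (pd_foot_r HQ a (sF d b))// mulr0 addr0.
Qed.

End Momentum.

(** The obstruction to the hypothesis of [recursion_square] is the contraction of
    p with the torsion of J.  [JJ] is J^2, of which only the derivative at [x]
    enters. *)
Lemma defect_square (J JJ : Q -> 'M[R]_n) (p : 'rV[R]_n) x :
  (forall u, dmx i u JJ x = dmx i u J x *m J x + J x *m dmx i u J x) ->
  (forall v w, torsion_at i (fun y => (J y)^T) x v w = 0) ->
  (J x)^T *m (defect J p x - (defect J p x)^T) +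
  (defect J p x - (defect J p x)^T) *m J x =
  defect JJ p x - (defect JJ p x)^T.
Proof.
move=> DJJ N0; apply: eq_mx_forms => v w.
have tr1 (X : 'M[R]_1) : X^T = X by apply/matrixP => a b; rewrite !ord1 mxE.
have flip (u1 u2 : 'rV[R]_n) (E : 'M[R]_n) : u1 *m E^T *m u2^T = u2 *m E *m u1^T.
  by rewrite -[LHS]tr1 !trmx_mul !trmxK mulmxA.
have tJ (u : 'rV[R]_n) : J x *m u^T = (u *m (J x)^T)^T by rewrite trmx_mul trmxK.
have flipJ (u1 : 'rV[R]_n) (E : 'M[R]_n) :
   u1 *m E^T *m (J x)^T *m p^T = p *m J x *m E *m u1^T.
  by rewrite -[LHS]tr1 !trmx_mul !trmxK !mulmxA.
have := N0 v w; rewrite /torsion_at => /(congr1 (fun N => N *m p^T)).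
rewrite mul0mx !(mulmxDl, mulNmx) !dmx_tr !flipJ !flip => N1.
have DE u := defect_dmx J p u x; have DE2 u := defect_dmx JJ p u x.
move: (defect J p x) (defect JJ p x) DE DE2 => E E2 DE DE2.
rewrite !(mulmxDr, mulmxDl, mulmxN, mulNmx) !mulmxA -!(mulmxA _ (J x) w^T).
rewrite !tJ !flip !DE !DE2 -!tJ !DJJ !(mulmxDr, mulmxDl) !mulmxA.
have mB (X Y : 'M[R]_1) : (X - Y) 0 0 = X 0 0 - Y 0 0 by rewrite !mxE.
have mD (X Y : 'M[R]_1) : (X + Y) 0 0 = X 0 0 + Y 0 0 by rewrite !mxE.
move: N1 => /(congr1 (fun X : 'M[R]_1 => X 0 0)).
rewrite !(mB, mD) [in X in _ = X -> _]mxE => N1.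
apply/matrixP => a b; rewrite !ord1 !(mB, mD); lra.
Qed.

Lemma dmx_foot p q u (F : Q -> 'M[R]_(p, q)) z : dom i (foot z) ->
  smooth_mx i F ->
  @dmx _ _ TQ i _ _ u (fun t => F (foot t)) z = dmx i (lsubmx u) F (foot z).
Proof.
move=> iz sF; apply/matrixP => a b; rewrite !mxE big_split_ord /=.
rewrite [X in _ + X]big1 => [|c _].
  rewrite addr0; apply: eq_bigr => c _.
  by rewrite (pd_foot_l HQ c (sF a b) iz) mxE.
by rewrite (pd_foot_r HQ c (sF a b) iz) mulr0.
Qed.

(** The torsion of an operator that projects onto [B] projects onto the torsion
    of [B]. *)
Lemma torsion_at_base (A : TQ -> 'M[R]_(n + n)) (B : Q -> 'M[R]_n) z v w :
  dom i (foot z) -> smooth_mx i B ->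
  (forall t, dom i (foot t) -> ulsubmx (A t) = B (foot t) /\ dlsubmx (A t) = 0) ->
  lsubmx (@torsion_at _ _ TQ i A z (row_mx v 0) (row_mx w 0)) =
  torsion_at i B (foot z) v w.
Proof.
move=> iz sB AB; have [ABz A0z] := AB z iz.
have lsub_mul (r : 'rV[R]_(n + n)) (X : 'M[R]_(n + n)) : dlsubmx X = 0 ->
    lsubmx (r *m X) = lsubmx r *m ulsubmx X.
  move=> X0; rewrite -{1}[r]hsubmxK -{1}[X]submxK X0 mul_row_block mulmx0 addr0.
  by rewrite row_mxKl.
have ul u : ulsubmx (@dmx _ _ TQ i _ _ u A z) = dmx i (lsubmx u) B (foot z).
  rewrite -(dmx_foot _ iz sB) -(dmx_eq aT (F := fun t => ulsubmx (A t)) u iz).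
    apply/matrixP => a b; rewrite !mxE; apply: eq_bigr => c _.
    have -> : (fun t => ulsubmx (A t) a b) = (fun t => A t (lshift n a) (lshift n b)).
      by apply/funext => t; rewrite !mxE.
    by [].
  by move=> t it; exact: (AB t it).1.
have dl u : dlsubmx (@dmx _ _ TQ i _ _ u A z) = 0.
  rewrite -(dmx_cst aT u (0 : 'M[R]_n) iz).
  rewrite -(dmx_eq aT (F := fun t => dlsubmx (A t)) u iz).
    apply/matrixP => a b; rewrite !mxE; apply: eq_bigr => c _.
    have -> : (fun t => dlsubmx (A t) a b) = (fun t => A t (rshift n a) (lshift n b)).
      by apply/funext => t; rewrite !mxE.
    by [].
  by move=> t it; exact: (AB t it).2.
have lB (X Y : 'rV[R]_(n + n)) : lsubmx (X - Y) = lsubmx X - lsubmx Y.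
  by rewrite linearB.
have lD (X Y : 'rV[R]_(n + n)) : lsubmx (X + Y) = lsubmx X + lsubmx Y.
  by rewrite linearD.
rewrite /torsion_at lB lD lB !lsub_mul ?dl// !ul !lsub_mul// !row_mxKl ABz.
by [].
Qed.

End Geometry.

Theorem proposition7 (R : realType) (n : nat) (Q : atlas R n)
    (HQ : smooth_manifold Q)
    (L : tangent_bundle Q -> R) (HL : smooth_function L) (Lreg : regular_lagrangian L)
    (J : mx_field Q) (HJ : is_tensor11 J)
    (Jc : mx_field (tangent_bundle Q)) (HJc : is_complete_lift J Jc)
    (T : mx_field (tangent_bundle Q)) (HT : is_tensor11 T)
    (Tdef : forall xi : row_field (tangent_bundle Q), is_vector_field xi ->
      agree (interior_product (tapp T xi) (diff1 (diffK (vertical_endomorphism Q) L)))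
            (interior_product xi
              (diff1 (diffK (tcompose Jc (vertical_endomorphism Q)) L)))) :
  nijenhuis_vanishes T <-> nijenhuis_vanishes J.
Proof.
have aQ := smooth_manifold_atlas HQ; have aT := tangent_atlas HQ.
have hT := tangent_hausdorff HQ.
have hQ := manifold_hausdorff HQ.
have sJ i : smooth_mx i (J i) by move=> a b; exact: HJ.1.
have sT i : smooth_mx i (T i) by move=> a b; exact: HT.1.
pose TQ := tangent_bundle Q.
pose p (i : chart Q) (z : TQ) : 'rV[R]_n := \row_a @pd _ _ TQ i (rshift n a) L z.
have thetaE (i : chart Q) (z : TQ) :
    diffK (vertical_endomorphism Q) L i z = row_mx (p i z) 0.
  rewrite /diffK /vertical_endomorphism -[diff0 L i z]hsubmxK mul_row_block.
  rewrite !mulmx0 !addr0 add0r mulmx1; congr row_mx.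
  by apply/rowP => a; rewrite !mxE.
have vertical_mul (v : 'rV[R]_n) (X : 'M[R]_(n + n)) :
    row_mx 0 v *m X^T = row_mx (v *m (ursubmx X)^T) (v *m (drsubmx X)^T).
  by rewrite -{1}[X]submxK tr_block_mx mul_row_block !mul0mx !add0r.
(* Vertical lifts span the u-directions, so they determine the right half of
   [Jc]; this is all that the composition with S retains. *)
have vertJ (i : chart Q) (z : TQ) : dom i (foot z) ->
    ursubmx (Jc i z) = 0 /\ drsubmx (Jc i z) = J i (foot z).
  move=> iz.
  have E (v : 'rV[R]_n) : v *m (ursubmx (Jc i z))^T = 0 /\
      v *m (drsubmx (Jc i z))^T = v *m (J i (foot z))^T.
    have [X vX Xv] := vector_field_through aQ hQ v iz.
    have [_ /(_ i z iz)] := HJc.2 X vX.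
    by rewrite /tapp /vertical_lift Xv vertical_mul => /eq_row_mx[-> ->].
  split; apply: trmx_inj; apply: eq_mx_rows => v; rewrite ?trmx0 ?mulmx0.
    exact: (E v).1.
  exact: (E v).2.
have thetaJE (i : chart Q) (z : TQ) : dom i (foot z) ->
    diffK (tcompose Jc (vertical_endomorphism Q)) L i z =
    row_mx (p i z *m J i (foot z)) 0.
  move=> iz; have [E1 E2] := vertJ i z iz.
  have -> : diffK (tcompose Jc (vertical_endomorphism Q)) L i z =
    diff0 L i z *m (Jc i z *m vertical_endomorphism Q i z) by [].
  rewrite -[Jc i z]submxK E1 E2 /vertical_endomorphism mulmx_block.
  rewrite !mulmx0 !mul0mx !addr0 !add0r mulmx1 -[diff0 L i z]hsubmxK mul_row_block.
  rewrite !mulmx0 !addr0 add0r; congr row_mx.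
  by congr (_ *m _); apply/rowP => a; rewrite !mxE.
have sp (i : chart Q) : @smooth_mx _ _ TQ i _ _ (p i).
  move=> a b; apply: (smooth_within_eq aT (f := @pd _ _ TQ i (rshift n b) L) (mopenT aT)).
    by move=> z _ _; rewrite mxE.
  exact: (smooth_within_pd aT _ (mopenT aT) (HL i)).
have spF (i : chart Q) (F : Q -> 'M[R]_n) : smooth_mx i F ->
    @smooth_mx _ _ TQ i _ _ (fun z => p i z *m F (foot z)).
  by move=> sF; apply: (smooth_mx_mul aT) => //; exact: (smooth_mx_foot HQ).
pose W0 (i : chart Q) := diff1 (diffK (vertical_endomorphism Q) L) i.
pose W1 (i : chart Q) := diff1 (diffK (tcompose Jc (vertical_endomorphism Q)) L) i.
pose JJ (i : chart Q) y := J i y *m J i y.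
pose theta2 : row_field TQ := fun i z => row_mx (p i z *m JJ i (foot z)) 0.
pose A (i : chart Q) (z : TQ) := (T i z)^T.
have sJJ i : smooth_mx i (JJ i) by exact: (smooth_mx_mul aQ).
(* The definition of [T] at a point, read off from global fields. *)
have AW0 (i : chart Q) (z : TQ) : dom i (foot z) -> A i z *m W0 i z = W1 i z.
  move=> iz; apply: eq_mx_rows => v.
  have [xi vxi <-] := vector_field_through aT hT (i := i) (x := z) v iz.
  have := Tdef xi vxi i z iz; rewrite /interior_product /tapp => <-.
  by rewrite mulmxA.
pose G (i : chart Q) (z : TQ) := base_jac i (p i) z.
pose H (i : chart Q) (z : TQ) := fibre_jac i (p i) z.
pose E (i : chart Q) (z : TQ) := defect i (J i) (p i z) (foot z).
pose E2 (i : chart Q) (z : TQ) := defect i (JJ i) (p i z) (foot z).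
have Hunit (i : chart Q) (z : TQ) : dom i (foot z) -> H i z \in unitmx.
  move=> iz; suff -> : H i z = hessian L i z by exact: Lreg.
  apply/matrixP => a b; rewrite !mxE.
  have -> : (fun t : TQ => p i t 0 b) = @pd _ _ TQ i (rshift n b) L.
    by apply/funext => t; rewrite mxE.
  by [].
have W0E (i : chart Q) (z : TQ) : dom i (foot z) ->
    W0 i z = form_block (G i z) (H i z).
  by move=> iz; apply: (diff1_horizontal HQ) => // t _.
have W1E (i : chart Q) (z : TQ) : dom i (foot z) ->
    W1 i z = form_block (G i z *m J i (foot z) + E i z) (H i z *m J i (foot z)).
  move=> iz; rewrite -(base_jac_mul HQ (sp i) (sJ i) iz).
  rewrite -(fibre_jac_mul HQ (sp i) (sJ i) iz).
  by apply: (diff1_horizontal HQ) => // t it; exact: thetaJE.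
(* [theta2] is the 1-form p_a (J^2)^a_b dq^b. *)
have W2E (i : chart Q) (z : TQ) : dom i (foot z) ->
    diff1 theta2 i z =
    form_block (G i z *m JJ i (foot z) + E2 i z) (H i z *m JJ i (foot z)).
  move=> iz; rewrite -(base_jac_mul HQ (sp i) (sJJ i) iz).
  rewrite -(fibre_jac_mul HQ (sp i) (sJJ i) iz).
  exact: (diff1_horizontal HQ).
have AO (i : chart Q) (z : TQ) : dom i (foot z) ->
    A i z *m form_block (G i z) (H i z) =
    form_block (G i z *m J i (foot z) + E i z) (H i z *m J i (foot z)).
  by move=> iz; rewrite -W0E// AW0// W1E.
have sTheta (i : chart Q) (q : TQ -> 'rV[R]_n) (th : row_field TQ) :
    @smooth_mx _ _ TQ i _ _ q ->
    (forall z : TQ, dom i (foot z) -> th i z = row_mx (q z) 0) ->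
    @smooth_mx _ _ TQ i _ _ (th i).
  move=> sq thq a c; rewrite (ord1 a); case: (split_ordP c) => b ->.
    apply: (smooth_within_eq aT (f := fun z => q z 0 b) (mopenT aT)) => [z iz _|].
      by rewrite thq// row_mxEl.
    exact: sq.
  apply: (smooth_within_eq aT (f := fun=> 0) (mopenT aT)) => [z iz _|].
    by rewrite thq// row_mxEr mxE.
  exact: (smooth_within_cst aT i _ (mopenT aT)).
have sth0 (i : chart Q) := sTheta i _ _ (sp i) (fun z _ => thetaE i z).
have sth1 (i : chart Q) := sTheta i _ _ (spF i _ (sJ i)) (thetaJE i).
have sth2 (i : chart Q) := sTheta i _ theta2 (spF i _ (sJJ i)) (fun z _ => erefl).
rewrite (nijenhuis_vanishesP aT hT sT) (nijenhuis_vanishesP aQ hQ sJ).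
split=> N0.
  move=> i x v w ix; have [z [zx _]] := tangent_vector_exists HQ 0 ix.
  have iz : dom i (foot z) by rewrite zx.
  have sJT := smooth_mx_tr aQ (sJ i).
  rewrite -zx -(torsion_at_base HQ (A := A i) v w iz sJT) => [|t it].
    by rewrite (N0 i z)// linear0.
  exact: (recursion_blocks (Hunit i t it) (AO i t it)).
move=> i z v w iz.
have unit0 : W0 i z \in unitmx by rewrite W0E//; exact/form_block_unit/Hunit.
rewrite -[LHS](mulmxK unit0) [X in X *m _](_ : _ = 0) ?mul0mx//.
apply: (@magri_morosi R _ TQ aT i (A i) (W0 i) (W1 i) (diff1 theta2 i)) => //.
- exact: (smooth_mx_tr aT (sT i)).
- exact: (smooth_diff1 aT (sth0 i)).
- exact: (smooth_diff1 aT (sth1 i)).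
- by move=> t _; exact: diff1_skew.
- by move=> t _; exact: diff1_skew.
- by move=> t _; exact: diff1_skew.
- by move=> t it; exact: AW0.
- move=> t it; rewrite W1E// W2E//; apply: (recursion_square (Hunit i t it) (AO i t it)).
  apply: defect_square => [u|v' w']; last exact: N0.
  exact: (dmx_mul aQ u it (sJ i) (sJ i)).
- exact: (diff1_closed aT iz (sth0 i)).
- exact: (diff1_closed aT iz (sth1 i)).
- exact: (diff1_closed aT iz (sth2 i)).
Qed.
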